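(* Let $\mathcal{O}=\{\mathcal{O}_1=(S_1,I_1,f_1),\mathcal{O}_2=(S_2,I_2,f_2),\ldots,\mathcal{O}_n=(S_n,I_n,f_n)\}$ be a geometric object consisting of $n$ atomic objects. Let $d$ be the maximal degree of any polynomial in the definition of the transformation functions $f_i$ ($1\le i\le n$). The spatio-temporal triangulation method $\mathcal{T}_{ST}$, applied to $\mathcal{O}$, returns $O(n^5d)$ atomic objects.
   Context: Geometric objects. An atomic (geometric) object is a triple $(S,I,f)$, where $S\subset\mathbb{R}^2$ (the spatial reference object) is a filled triangle, allowed to degenerate into a line segment or a point, whose corner points have rational or algebraic coordinates; $I\subset\mathbb{R}$ (the time domain) is a point or an interval; and $f:\mathbb{R}^2\times\mathbb{R}\to\mathbb{R}^2$ (the transformation function) is a time-dependent affinity $(x,y;t)\mapsto A(t)\binom{x}{y}+b(t)$, where the entries of the $2\times 2$ matrix $A(t)$ and of the vector $b(t)$ are rational functions of $t$ (quotients of polynomials with rational coefficients) and $\det A(t)\neq 0$ for all $t\in I$. A geometric object is a finite set of atomic objects; its time domain is the convex closure of the union of the time domains of its atomic objects. Its snapshot at time $\tau$ is $\mathcal{O}^\tau=\bigcup_{i:\tau\in I_i}f_i(S_i,\tau)\subseteq\mathbb{R}^2$, given by the triangles $f_i(S_i,\tau)$. Procedure Partition. On input $\mathcal{O}$: (1) let $\chi$ be the sorted list of all begin and end points of the $I_i$; (2) let $\mathcal{C}$ consist of the objects $(S_{i,\ell},I_i,f_i)$, $1\le i\le n$, $1\le\ell\le 3$, where $S_{i,1},S_{i,2},S_{i,3}$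 are the boundary segments of $S_i$; the (time-dependent) carrier of such an object is the line through $f_i(S_{i,\ell},t)$; (3) for all pairs $(S_{i,\ell_1},I_i,f_i),(S_{j,\ell_2},I_j,f_j)$ of $\mathcal{C}$ with $1\le i<j\le n$, $1\le\ell_1,\ell_2\le3$ and $I_i\cap I_j\neq\emptyset$, compute the end points of the intervals during which the intersection of the two carriers exists, and add those lying within $I_i\cap I_j$ to $\chi$; (4) for all triples $(S_{i,\ell_1},I_i,f_i),(S_{j,\ell_2},I_j,f_j),(S_{k,\ell_3},I_k,f_k)$ of $\mathcal{C}$ with $1\le i<j<k\le n$, $1\le\ell_1,\ell_2,\ell_3\le3$ and $I_i\cap I_j\cap I_k\neq\emptyset$, compute the end points of the intervals during which the three carriers intersect in one point, and add those lying within $I_i\cap I_j\cap I_k$ to $\chi$; (5) return the sorted list $\chi$, which partitions the time domain into the listed points $\tau_j$ and the open intervals $]\tau_j,\tau_{j+1}[$. Spatial triangulation method $\mathcal{T}_S$. The input is a set $S\subset\mathbb{R}^2$ given as a finite set of (possibly overlapping, possibly degenerate) triangles. Compute the set $\mathcal{B}(S)$ of all line segments bounding an input triangle that contribute to the boundary of $S$ (contain an edge of the boundary), the planar subdivision $\mathcal{U}(S)$ induced by the input triangles, and the convex hull of $S$. The lines through the segments in $\mathcal{B}(S)$ subdivide the convex hull into open convex polygons, open line segments and points. For each polygon, let $a$ be its center of mass, computed as the average of its vertices; if $a$ belongs to a face of $\mathcal{U}(S)$ (so that the polygon belongs to $S$), add to the output, for each edge $a_sa_e$ of the polygon, the closed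 triangle with corner points $a,a_s,a_e$. Lower-dimensional parts: input points that are not part of an input segment or triangle are added to the output directly, and for each open line segment of the subdivision that is part of an input line segment contributing to the boundary of $S$, its closure is added to the output. (The formal description of the method is given under the simplification that $S$ is fully two-dimensional or, equivalently, that points and line segments not adjacent to a polygon belonging to $S$ are already in the output.) Procedure Triangulate. Input: $\mathcal{O}$ and $\chi=(\tau_1,\ldots,\tau_k)$. (i) For each $\tau_j$ in $\chi$ and each triangle $T$ in $\mathcal{T}_S(\mathcal{O}^{\tau_j})$, return the atomic object $(T,\{\tau_j\},\mathrm{Id})$. (ii) For each pair of consecutive moments $\tau_j,\tau_{j+1}$ of $\chi$, let $\tau_m=\frac12(\tau_j+\tau_{j+1})$ and compute the spatial triangulation of the snapshot $\mathcal{O}^{\tau_m}$ by $\mathcal{T}_S$, copying every action on a point or line segment at time $\tau_m$ to the moving point or moving line segment of which it is the snapshot (so that whenever an intersection point of two carriers or a center of mass is computed, the formula, in rational functions of $t$, for the corresponding moving point is computed as well). For each triangle $T$ so obtained, output the atomic object $(T,\,]\tau_j,\tau_{j+1}[,\,f)$, where the transformation function $f$ is computed from the functions describing the moving corner points of $T$. Procedure Merge. Run through the elements (points and intervals) of the time partition in order, merging consecutive ones when possible. A point $\tau$ and an adjacent interval $J$ can be merged if there is a one-to-one mapping $M$ from the atomic objects with time domain $J$ to those with time domain $\{\tau\}$ such that $(S_2,\{\tau\},\mathrm{Id})=M((S_1,J,f_1))$ if and only if $\lim_{t\to\tau}f_1(S_1,t)=S_2$ (one-sided limit from within $J$; this equals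 $f_1(S_1,\tau)$ provided $\tau$ is in the domain of $f_1$, i.e., its coefficients are well-defined and its determinant is nonzero at $\tau$); the objects at $\tau$ are then removed and the time domains of the objects on $J$ extended to $J\cup\{\tau\}$. Two adjacent intervals, one ending openly at $\tau$ and one containing its end point $\tau$ (or symmetrically), can be merged if the objects of each interval have transformation functions whose domain includes the other interval, if the open one can be extended to $\tau$ by the tests above, and if for matching atomic objects the combination is again an atomic object, i.e., the transformation functions coincide once the same reference object is chosen. Method $\mathcal{T}_{ST}$. On input $\mathcal{O}$: compute $\chi$ by Partition; apply Triangulate to $\mathcal{O}$ and $\chi$; if $\chi$ has more than one element, apply Merge to the result; return the resulting set of atomic objects. *)

(* Defs.v *)
From HB Require Import structures.
From mathcomp Require Import all_boot all_order all_algebra finmap.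
From mathcomp Require Import all_classical all_reals all_analysis.

Set Implicit Arguments.
Unset Strict Implicit.
Unset Printing Implicit Defensive.

Import Order.TTheory GRing.Theory Num.Theory.
Import numFieldNormedType.Exports.

Local Open Scope classical_set_scope.
Local Open Scope ring_scope.

Notation point R := 'cV[R]_2 (only parsing).

(* The three corners; repetitions and collinear corners encode the degenerate
   triangles (line segments and points). *)
Notation triangle R := {ffun 'I_3 -> 'cV[R]_2} (only parsing).

Definition hull (R : realType) (A : set (point R)) : set (point R) :=
  smallest (@convex_set R 'cV[R]_2) A.

Definition segment (R : realType) (a b : point R) : set (point R) :=
  hull [set a; b].

Definition filled (R : realType) (T : triangle R) : set (point R) :=
  hull (range T).

Definition side (R : realType) (T : triangle R) (l : 'I_3) :
    point R * point R := (T l, T (ordS l)).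

Definition frontier (R : realType) (A : set (point R)) : set (point R) :=
  closure A `\` interior A.

(* The line through p and q, and the point p if p = q. *)
Definition line (R : realType) (p q : point R) : set (point R) :=
  [set x | exists c : R, x = p + c *: (q - p)].

Definition cross (R : realType) (u v : point R) : R :=
  u 0 0 * v 1 0 - u 1 0 * v 0 0.

(* Its sign tells on which side of the line through a and b the point x is. *)
Definition orient (R : realType) (a b x : point R) : R :=
  cross (b - a) (x - a).

(* The intersection point, by Cramer's rule, of the lines pq and rs. *)
Definition meet_point (R : realType) (p q r s : point R) : point R :=
  p + (cross (r - p) (s - r) / cross (q - p) (s - r)) *: (q - p).

(* Extreme points of a convex set. *)
Definition vertex (R : realType) (P : set (point R)) : set (point R) :=
  [set v | P v /\ forall x y, P x -> P y -> v = 2^-1 *: (x + y) -> x = y].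

Definition edge (R : realType) (P : set (point R)) (a b : point R) : Prop :=
  [/\ a != b, vertex P a, vertex P b & segment a b `<=` frontier P].

(* Only used on finite sets V. *)
Definition average (R : realType) (V : set (point R)) (g : point R -> point R) :
    point R :=
  (#|` fset_set V|)%:R^-1 *: \sum_(v \in V) g v.

Definition region (R : realType) (s : seq (triangle R)) : set (point R) :=
  [set x | exists2 T, T \in s & filled T x].

Definition contributes (R : realType) (s : seq (triangle R)) (a b : point R) :
    Prop :=
  exists u v, u != v /\ segment u v `<=` segment a b `&` frontier (region s).

Definition bounding_segments (R : realType) (s : seq (triangle R)) :
    set (point R * point R) :=
  [set e | (exists T l, T \in s /\ e = side T l) /\ contributes s e.1 e.2].

(* x and y lie in the same relatively open face of the convex set H: the segment
   xy can be prolonged inside H beyond both x and y. *)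
Definition same_face (R : realType) (H : set (point R)) (x y : point R) : Prop :=
  exists2 e : R, 0 < e & H (x + e *: (x - y)) /\ H (y + e *: (y - x)).

(* The cell of x in the subdivision of the convex hull by the lines through the
   bounding segments: an open polygon, an open segment or a point. *)
Definition cell_of (R : realType) (s : seq (triangle R)) (x : point R) :
    set (point R) :=
  [set y | [/\ hull (region s) y, same_face (hull (region s)) x y &
     forall e, bounding_segments s e ->
       Num.sg (orient e.1 e.2 y) = Num.sg (orient e.1 e.2 x)]].

Definition cell (R : realType) (s : seq (triangle R)) (C : set (point R)) :
    Prop :=
  exists2 x, hull (region s) x & C = cell_of s x.

Definition polygon_cell (R : realType) (s : seq (triangle R))
    (C : set (point R)) : Prop :=
  cell s C /\ interior C !=set0.

Definition segment_cell (R : realType) (s : seq (triangle R))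
    (C : set (point R)) : Prop :=
  [/\ cell s C, interior C = set0 & exists a b, [/\ a != b, C a & C b]].

Definition center (R : realType) (C : set (point R)) : point R :=
  average (vertex (closure C)) id.

(* The polygon C belongs to the region. An edge between two input triangles that
   is interior to the region does not bound a bounding segment, and the center
   may lie on it (two triangles making up a square): the faces that the center is
   tested against are those left after erasing such edges, whose union is the
   interior of the region. *)
Definition inner_polygon (R : realType) (s : seq (triangle R))
    (C : set (point R)) : Prop :=
  polygon_cell s C /\ interior (region s) (center C).

Definition is_point (R : realType) (T : triangle R) : Prop :=
  exists p, filled T = [set p].

Definition spatial_triangulation (R : realType) (s : seq (triangle R)) :
    set (set (point R)) :=
  [set D | exists C a b, [/\ inner_polygon s C, edge (closure C) a b &
             D = hull [set center C; a; b]]] `|`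
  [set D | exists C T a b,
             [/\ segment_cell s C,
                 [/\ T \in s, a != b & filled T = segment a b],
                 contributes s a b, C `<=` filled T & D = closure C]] `|`
  [set D | exists2 T, T \in s & [/\ is_point T, D = filled T &
             forall T', T' \in s -> ~ is_point T' ->
               ~ (filled T `<=` filled T')]].

(* ts lists every triangle of D once, the degenerate ones with repeated corners. *)
Definition lists (R : realType) (ts : seq (triangle R))
    (D : set (set (point R))) : Prop :=
  [/\ uniq [seq filled T | T <- ts],
      forall X, D X <-> X \in [seq filled T | T <- ts] &
      forall T k, T \in ts -> vertex (filled T) (T k)].

(* A numerator and a denominator. *)
Notation ratfun R := ({poly R} * {poly R})%type (only parsing).

Definition rat_def (R : realType) (r : ratfun R) (t : R) : Prop := r.2.[t] != 0.

Definition rat_eval (R : realType) (r : ratfun R) (t : R) : R :=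
  r.1.[t] / r.2.[t].

Definition rat_degree (R : realType) (r : ratfun R) : nat :=
  maxn (size r.1).-1 (size r.2).-1.

Definition rational_coefs (R : realType) (r : ratfun R) : Prop :=
  exists p q : {poly rat}, r = (map_poly ratr p, map_poly ratr q).

(* The matrix A and the vector b. *)
Notation transf R := ('M[{poly R} * {poly R}]_2 * 'cV[{poly R} * {poly R}]_2)%type
  (only parsing).

Definition transf_def (R : realType) (f : transf R) (t : R) : Prop :=
  (forall i j, rat_def (f.1 i j) t) /\ (forall i, rat_def (f.2 i 0) t).

Definition matrix_at (R : realType) (f : transf R) (t : R) : 'M[R]_2 :=
  map_mx (fun r => rat_eval r t) f.1.

Definition act (R : realType) (f : transf R) (t : R) (x : point R) : point R :=
  matrix_at f t *m x + map_mx (fun r => rat_eval r t) f.2.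

(* t is in the domain of f. *)
Definition affinity_at (R : realType) (f : transf R) (t : R) : Prop :=
  transf_def f t /\ \det (matrix_at f t) != 0.

Definition transf_id (R : realType) : transf R :=
  (\matrix_(i, j) ((i == j)%:R, 1), const_mx (0, 1)).

Definition transf_degree (R : realType) (f : transf R) : nat :=
  maxn (\max_i \max_j rat_degree (f.1 i j)) (\max_i rat_degree (f.2 i ord0)).

Record object (R : realType) := Object {
  ref : triangle R;
  dom : interval R;
  tf : transf R }.

Definition atomic (R : realType) (o : object R) : Prop :=
  [/\ forall k i, algebraicOver (ratr : rat -> R) (ref o k i 0),
      [set` dom o] !=set0,
      (forall i j, rational_coefs ((tf o).1 i j)) /\
      (forall i, rational_coefs ((tf o).2 i 0)) &
      forall t, t \in dom o -> affinity_at (tf o) t].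

Definition max_degree (R : realType) (n : nat) (O : 'I_n -> object R) : nat :=
  \max_i transf_degree (tf (O i)).

Definition moving_corner (R : realType) (o : object R) (k : 'I_3) (t : R) :
    point R := act (tf o) t (ref o k).

Definition snapshot (R : realType) (n : nat) (O : 'I_n -> object R) (t : R) :
    seq (triangle R) :=
  [seq [ffun k => moving_corner (O i) k t] | i <- enum 'I_n & t \in dom (O i)].

Definition ends (R : realType) (J : interval R) : set R :=
  let: Interval l u := J in
  [set t | exists b, l = BSide b t \/ u = BSide b t].

Definition maximal_interval (R : realType) (E : set R) (J : interval R) : Prop :=
  [/\ [set` J] !=set0, [set` J] `<=` E &
      forall J' : interval R, [set` J] `<=` [set` J'] -> [set` J'] `<=` E ->
        [set` J'] `<=` [set` J]].

(* The end points lying in D of the intervals of D during which P holds. *)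
Definition events (R : realType) (D : set R) (P : R -> Prop) : set R :=
  [set t | D t /\ exists2 J, maximal_interval (D `&` P) J & ends J t].

Definition carrier (R : realType) (o : object R) (l : 'I_3) (t : R) :
    set (point R) :=
  line (moving_corner o l t) (moving_corner o (ordS l) t).

Definition partition_points (R : realType) (n : nat) (O : 'I_n -> object R) :
    set R :=
  [set t | exists i, ends (dom (O i)) t] `|`
  [set t | exists (i j : 'I_n) l1 l2, (i < j)%N /\
     events ([set` dom (O i)] `&` [set` dom (O j)])
       (fun t => carrier (O i) l1 t `&` carrier (O j) l2 t !=set0) t] `|`
  [set t | exists (i j k : 'I_n) l1 l2 l3, (i < j < k)%N /\
     events ([set` dom (O i)] `&` [set` dom (O j)] `&` [set` dom (O k)])
       (fun t => exists x, carrier (O i) l1 t `&` carrier (O j) l2 t `&`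
                             carrier (O k) l3 t = [set x]) t].

Definition time_partition (R : realType) (n : nat) (O : 'I_n -> object R)
    (chi : seq R) : Prop :=
  sorted <%R chi /\ forall t, partition_points O t <-> t \in chi.

(* An element of the time partition with its atomic objects. *)
Notation slab R := (interval R * seq ({ffun 'I_3 -> 'cV[R]_2} *
  ('M[{poly R} * {poly R}]_2 * 'cV[{poly R} * {poly R}]_2)))%type
  (only parsing).

Definition at_moment (R : realType) (n : nat) (O : 'I_n -> object R) (t : R)
    (sl : slab R) : Prop :=
  exists2 ts, lists ts (spatial_triangulation (snapshot O t)) &
    sl = (`[t, t], [seq (T, transf_id R) | T <- ts]).

Notation moving_point R := 'cV[{poly R} * {poly R}]_2 (only parsing).

Definition moving_def (R : realType) (g : moving_point R) (t : R) : Prop :=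
  forall i, rat_def (g i 0) t.

Definition moving_eval (R : realType) (g : moving_point R) (t : R) : point R :=
  map_mx (fun r => rat_eval r t) g.

(* g is the formula of h: equality of rational functions is equality at all but
   finitely many moments. *)
Definition formula_of (R : realType) (g : moving_point R) (h : R -> point R) :
    Prop :=
  finite_set [set t | ~ (moving_def g t /\ moving_eval g t = h t)].

(* The moving lines that are cut at time tau: the carriers of the bounding
   segments, and the lines through the edges of the convex hull. *)
Inductive moving_line (R : realType) (n : nat) (O : 'I_n -> object R) (tau : R) :
    (R -> point R) -> (R -> point R) -> Prop :=
| moving_carrier i l of tau \in dom (O i) &
    bounding_segments (snapshot O tau)
      (moving_corner (O i) l tau, moving_corner (O i) (ordS l) tau) :
    moving_line O tau (moving_corner (O i) l) (moving_corner (O i) (ordS l))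
| moving_hull_edge i j k l of tau \in dom (O i) & tau \in dom (O j) &
    edge (hull (region (snapshot O tau)))
      (moving_corner (O i) k tau) (moving_corner (O j) l tau) :
    moving_line O tau (moving_corner (O i) k) (moving_corner (O j) l).

(* h is a moving point of which v is the snapshot at time tau. *)
Inductive moves_as (R : realType) (n : nat) (O : 'I_n -> object R) (tau : R) :
    point R -> (R -> point R) -> Prop :=
| moves_as_corner i k of tau \in dom (O i) :
    moves_as O tau (moving_corner (O i) k tau) (moving_corner (O i) k)
| moves_as_meet p q r s of moving_line O tau p q & moving_line O tau r s &
    cross (q tau - p tau) (s tau - r tau) != 0 :
    moves_as O tau (meet_point (p tau) (q tau) (r tau) (s tau))
      (fun t => meet_point (p t) (q t) (r t) (s t)).

(* mv assigns to each point computed at time tau the formula of the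
   corresponding moving point. *)
Definition moving_points (R : realType) (n : nat) (O : 'I_n -> object R)
    (tau : R) (mv : point R -> moving_point R) : Prop :=
  let s := snapshot O tau in
  (forall D v, spatial_triangulation s D -> vertex D v ->
     (forall C, inner_polygon s C -> v <> center C) ->
     exists2 h, moves_as O tau v h & formula_of (mv v) h) /\
  (forall C, inner_polygon s C ->
     formula_of (mv (center C))
       (fun t => average (vertex (closure C)) (fun v => moving_eval (mv v) t))).

(* f is computed from the moving corner points of T: it moves the corners of T
   along them and is an affinity at each moment of J at which an affinity doing
   this exists. *)
Definition computed_from (R : realType) (J : interval R)
    (mv : point R -> moving_point R) (T : triangle R) (f : transf R) : Prop :=
  (forall k, finite_set [set t | ~ [/\ transf_def f t, moving_def (mv (T k)) t &
                                     act f t (T k) = moving_eval (mv (T k)) t]]) /\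
  (forall t, t \in J -> (forall k, moving_def (mv (T k)) t) ->
     (exists (A : 'M[R]_2) (b : 'cV[R]_2), \det A != 0 /\
        forall k, A *m T k + b = moving_eval (mv (T k)) t) ->
     affinity_at f t).

Definition on_interval (R : realType) (n : nat) (O : 'I_n -> object R)
    (t1 t2 : R) (sl : slab R) : Prop :=
  let tm := 2^-1 * (t1 + t2) in
  exists objs mv,
    [/\ lists [seq o.1 | o <- objs] (spatial_triangulation (snapshot O tm)),
        moving_points O tm mv,
        forall o, o \in objs -> computed_from `]t1, t2[ mv o.1 o.2 &
        sl = (`]t1, t2[, objs)].

Inductive triangulate (R : realType) (n : nat) (O : 'I_n -> object R) :
    seq R -> seq (slab R) -> Prop :=
| triangulate_nil : triangulate O [::] [::]
| triangulate_last t p of at_moment O t p : triangulate O [:: t] [:: p]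
| triangulate_cons t t' chi p sl slabs of at_moment O t p &
    on_interval O t t' sl & triangulate O (t' :: chi) slabs :
    triangulate O [:: t, t' & chi] [:: p, sl & slabs].

Definition image_at (R : realType) (o : triangle R * transf R) (t : R) :
    set (point R) := [set act o.2 t x | x in filled o.1].

(* The limit, for t tending to tau from within J, of the moving triangle is D. *)
Definition limit_is (R : realType) (J : interval R) (tau : R)
    (o : triangle R * transf R) (D : set (point R)) : Prop :=
  exists g : point R -> point R,
    (forall x, filled o.1 x ->
       (fun t => act o.2 t x) @ within [set` J] (nbhs tau) --> g x) /\
    D = [set g x | x in filled o.1].

(* M matches the objects on J, which is open at tau, with the objects at tau. *)
Definition extends_by (R : realType) (J : interval R) (tau : R)
    (objs objs' : seq (triangle R * transf R))
    (M : 'I_(size objs) -> 'I_(size objs')) : Prop :=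
  [/\ bijective M,
      forall i j, M i = j <->
        limit_is J tau (tnth (in_tuple objs) i)
          (image_at (tnth (in_tuple objs') j) tau) &
      forall o, o \in objs -> affinity_at o.2 tau].

(* The matching objects on the adjacent intervals J and J' are the same moving
   object, up to the choice of the reference object. *)
Definition combine_by (R : realType) (J J' : interval R)
    (objs objs' : seq (triangle R * transf R))
    (M : 'I_(size objs) -> 'I_(size objs')) : Prop :=
  [/\ forall o t, o \in objs -> t \in J' -> affinity_at o.2 t,
      forall o t, o \in objs' -> t \in J -> affinity_at o.2 t &
      forall i, let o := tnth (in_tuple objs) i in
        let o' := tnth (in_tuple objs') (M i) in
        exists (A : 'M[R]_2) (b : 'cV[R]_2),
          [/\ \det A != 0,
              [set A *m x + b | x in filled o.1] = filled o'.1 &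
              forall t x, (t \in J) || (t \in J') -> filled o.1 x ->
                act o.2 t x = act o'.2 t (A *m x + b)]].

Inductive merge2 (R : realType) : slab R -> slab R -> slab R -> Prop :=
| merge_point_left tau u objs pobjs M of
    extends_by (Interval (BRight tau) u) tau (objs := objs) (objs' := pobjs) M :
    merge2 (`[tau, tau], pobjs) (Interval (BRight tau) u, objs)
           (Interval (BLeft tau) u, objs)
| merge_point_right tau l objs pobjs M of
    extends_by (Interval l (BLeft tau)) tau (objs := objs) (objs' := pobjs) M :
    merge2 (Interval l (BLeft tau), objs) (`[tau, tau], pobjs)
           (Interval l (BRight tau), objs)
| merge_open_left tau l u objs objs' M of u != BRight tau &
    extends_by (Interval l (BLeft tau)) tau (objs := objs) (objs' := objs') M &
    combine_by (Interval l (BLeft tau)) (Interval (BLeft tau) u)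
      (objs := objs) (objs' := objs') M :
    merge2 (Interval l (BLeft tau), objs) (Interval (BLeft tau) u, objs')
           (Interval l u, objs)
| merge_open_right tau l u objs objs' M of l != BLeft tau &
    extends_by (Interval (BRight tau) u) tau (objs := objs) (objs' := objs') M &
    combine_by (Interval (BRight tau) u) (Interval l (BRight tau))
      (objs := objs) (objs' := objs') M :
    merge2 (Interval l (BRight tau), objs') (Interval (BRight tau) u, objs)
           (Interval l u, objs).

(* merge_from s rest out: the run whose current element is s. *)
Inductive merge_from (R : realType) :
    slab R -> seq (slab R) -> seq (slab R) -> Prop :=
| merge_end s : merge_from s [::] [:: s]
| merge_join s s' m rest out of merge2 s s' m & merge_from m rest out :
    merge_from s (s' :: rest) out
| merge_skip s s' rest out of (forall m, ~ merge2 s s' m) &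
    merge_from s' rest out :
    merge_from s (s' :: rest) (s :: out).

Inductive merge_all (R : realType) : seq (slab R) -> seq (slab R) -> Prop :=
| merge_none : merge_all [::] [::]
| merge_run s rest out of merge_from s rest out : merge_all (s :: rest) out.

Definition objects_of (R : realType) (slabs : seq (slab R)) : seq (object R) :=
  flatten [seq [seq Object o.1 sl.1 o.2 | o <- sl.2] | sl <- slabs].

(* out is a result of applying the method to O. *)
Definition st_triangulation (R : realType) (n : nat) (O : 'I_n -> object R)
    (out : seq (object R)) : Prop :=
  exists chi slabs slabs',
    [/\ time_partition O chi, triangulate O chi slabs,
        (if (1 < size chi)%N then merge_all slabs slabs' else slabs' = slabs) &
        out = objects_of slabs'].

(* Main.v *)
From HB Require Import structures.
From mathcomp Require Import all_boot all_order all_algebra.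
From mathcomp Require Import all_classical all_reals all_analysis.
From mathcomp Require Import ring lra zify.
Require Import Defs.

(** Cells are the classes of an equivalence relation, so two cells that share a point coincide. All
    the determinations by keys rest on this: a point common to both cells is exhibited, just beside
    the common initial part of two edges or just below a common last end point. No Euler formula and
    no incidence structure of the subdivision is involved. Vertices and edges are defined for
    arbitrary convex sets by extreme points. They become accessible because the closure of a polygon
    is cut out of H by weak inequalities: a small displacement that stays in H and is parallel to
    all the lines through a point preserves these inequalities, and an extreme point does not admit
    it in both directions. On the side of time, an event is an end of a maximal interval, which may
    also come from an end of a time domain; these moments are set aside, and elsewhere the
    predicates are constant near the moment. Carriers are whole lines, or points for degenerate
    sides, so their meeting is a Boolean combination of equations, without inequalities. *)

(** The partition has O(n^3 d) elements: in the time domain of two or three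
    atomic objects, whether their carriers meet is decided by the vanishing of
    rational functions of degree O(d), hence changes only at O(d) moments, and
    every event is such a moment or an end point of a time domain.  Each
    snapshot consists of at most n triangles and gives O(n^2) triangles. Indeed,
    a line of the subdivision contains O(n) candidates for vertices of cells:
    corners of the convex hull H, its crossings with the other lines, and the
    extreme points of its intersection with H. An edge of a cell that lies on
    a line is determined by its first vertex, its direction and the side of its
    cell; an edge on the boundary of H by its first vertex and the side of H,
    where the first vertex is one of the O(n^2) candidates altogether. A segment
    cell is determined by its line and its last end point, again a candidate.
    Merging never increases the number of atomic objects. *)

Set Implicit Arguments.
Unset Strict Implicit.
Unset Printing Implicit Defensive.

Import Order.TTheory GRing.Theory Num.Theory.
Import numFieldNormedType.Exports.

Local Open Scope classical_set_scope.
Local Open Scope ring_scope.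

(** * Predicates of time that change at few moments *)

Lemma poly_roots_seq (R : fieldType) (p : {poly R}) : p != 0 ->
  exists Z : seq R, (size Z <= (size p).-1)%N /\ forall t, root p t -> t \in Z.
Proof.
have [n] := ubnP (size p); elim: n p => // n IHn p szp p0.
have [[t pt]|noroot] := pselect (exists t, root p t); last first.
  by exists [::]; split => // t pt; case: noroot; exists t.
have /factor_theorem[q pq] := pt.
have q0 : q != 0 by apply: contraNneq p0 => q0; rewrite pq q0 mul0r.
have szpq : size p = (size q).+1 by rewrite pq size_Mmonic ?monicXsubC// size_XsubC addn2.
have [||Z [szZ rZ]] := IHn q => //; first by rewrite szpq in szp.
exists (t :: Z); split=> [|x].
  by rewrite /= szpq /= -(prednK (n := size q)) ?ltnS ?size_poly_gt0.
rewrite pq rootM root_XsubC inE orbC => /orP[->//|/rZ ->].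
by rewrite orbT.
Qed.

(** One truth value on all of [D] outside [Z], not one for each interval between exceptional
    moments: this suits equations between rational functions, though not inequalities, and passes to
    Boolean combinations with bounds that at most add up. *)
Definition tame (R : realType) (D : set R) (N : nat) (P : R -> Prop) : Prop :=
  exists Z : seq R, (size Z <= N)%N /\
    forall x y, D x -> D y -> x \notin Z -> y \notin Z -> P x -> P y.

Section tame.
Variables (R : realType) (D : set R).
Implicit Types P Q : R -> Prop.

Lemma tame_ext N P Q : (forall t, D t -> (P t <-> Q t)) ->
  tame D N P -> tame D N Q.
Proof.
move=> PQ [Z [szZ cZ]]; exists Z; split=> // x y Dx Dy xZ yZ /(PQ _ Dx) Px.
by apply/(PQ _ Dy); exact: (cZ x y).
Qed.

Lemma tame_and N1 N2 P Q : tame D N1 P -> tame D N2 Q ->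
  tame D (N1 + N2) (fun t => P t /\ Q t).
Proof.
move=> [Z1 [sz1 c1]] [Z2 [sz2 c2]]; exists (Z1 ++ Z2).
rewrite size_cat leq_add//; split=> // x y Dx Dy.
rewrite !mem_cat !negb_or => /andP[x1 x2] /andP[y1 y2] [Px Qx].
by split; [exact: (c1 x y)|exact: (c2 x y)].
Qed.

Lemma tame_or N1 N2 P Q : tame D N1 P -> tame D N2 Q ->
  tame D (N1 + N2) (fun t => P t \/ Q t).
Proof.
move=> [Z1 [sz1 c1]] [Z2 [sz2 c2]]; exists (Z1 ++ Z2).
rewrite size_cat leq_add//; split=> // x y Dx Dy.
rewrite !mem_cat !negb_or => /andP[x1 x2] /andP[y1 y2] [Px|Qx].
  by left; exact: (c1 x y).
by right; exact: (c2 x y).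
Qed.

Lemma tame_not N P : tame D N P -> tame D N (fun t => ~ P t).
Proof.
move=> [Z [sz c]]; exists Z; split=> // x y Dx Dy xZ yZ nPx Py.
by apply: nPx; exact: (c y x).
Qed.

(** The identity is asked on [D] only, where the denominator has no zero. [N] bounds the degrees of
    numerator and denominator alike, so that the bounds add under sums as well as under products. *)
Definition frac_on (N : nat) (h : R -> R) : Prop :=
  exists p q : {poly R}, [/\ (size p <= N.+1)%N, (size q <= N.+1)%N &
    forall t, D t -> q.[t] != 0 /\ h t = p.[t] / q.[t]].

Lemma frac_on_cst N c : frac_on N (fun=> c).
Proof.
exists c%:P, 1; split.
- by rewrite (leq_trans (size_polyC_leq1 _)).
- by rewrite size_poly1.
- by move=> t _; rewrite !hornerE oner_eq0 divr1.
Qed.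

Lemma frac_on_opp N f : frac_on N f -> frac_on N (fun t => - f t).
Proof.
move=> [p [q [sp sq e]]]; exists (- p), q; split=> //; first by rewrite size_polyN.
by move=> t /e[q0 ->]; split=> //; rewrite hornerN mulNr.
Qed.

Lemma size_mul_leqD (p q : {poly R}) M N :
  (size p <= M.+1)%N -> (size q <= N.+1)%N -> (size (p * q)%R <= (M + N).+1)%N.
Proof. by move=> sp sq; apply: (leq_trans (size_polyMleq _ _)); lia. Qed.

Lemma frac_on_add M N f g : frac_on M f -> frac_on N g ->
  frac_on (M + N) (fun t => f t + g t).
Proof.
move=> [p [q [sp sq e]]] [p' [q' [sp' sq' e']]].
exists (p * q' + p' * q), (q * q'); split.
- rewrite (leq_trans (size_polyD _ _))// geq_max size_mul_leqD//=.
  by rewrite addnC size_mul_leqD.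
- exact: size_mul_leqD.
- move=> t Dt; have [q0 ->] := e t Dt; have [q'0 ->] := e' t Dt.
  by rewrite !hornerE mulf_neq0//; split=> //; field; rewrite q0 q'0.
Qed.

Lemma frac_on_sub M N f g : frac_on M f -> frac_on N g ->
  frac_on (M + N) (fun t => f t - g t).
Proof. by move=> Mf /frac_on_opp; exact: frac_on_add. Qed.

Lemma frac_on_mul M N f g : frac_on M f -> frac_on N g ->
  frac_on (M + N) (fun t => f t * g t).
Proof.
move=> [p [q [sp sq e]]] [p' [q' [sp' sq' e']]].
exists (p * p'), (q * q'); split; try exact: size_mul_leqD.
move=> t Dt; have [q0 ->] := e t Dt; have [q'0 ->] := e' t Dt.
by rewrite !hornerM mulf_neq0// invfM; split=> //; rewrite mulrACA.
Qed.

Lemma frac_on_ext N f g : (forall t, D t -> f t = g t) ->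
  frac_on N f -> frac_on N g.
Proof.
move=> fg [p [q [sp sq e]]]; exists p, q; split=> // t Dt.
by have [q0 <-] := e t Dt; rewrite fg.
Qed.

Lemma frac_on_leq M N f : (M <= N)%N -> frac_on M f -> frac_on N f.
Proof.
by move=> MN [p [q [sp sq e]]]; exists p, q; split=> //; [exact: leq_trans sp _|exact: leq_trans sq _].
Qed.

(** Either the numerator is the zero polynomial and [f] vanishes on all of [D], or [f] vanishes on
    [D] at most at the roots of the numerator. *)
Lemma tame_eq0 N f : frac_on N f -> tame D N (fun t => f t = 0).
Proof.
move=> [p [q [sp sq e]]].
have [p0|p0] := eqVneq p 0.
  exists [::]; split=> // x y Dx Dy _ _ _.
  by have [_ ->] := e y Dy; rewrite p0 horner0 mul0r.
have [Z [szZ rZ]] := poly_roots_seq p0; exists Z; split.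
  by rewrite (leq_trans szZ)// -ltnS (leq_trans _ sp)// ltn_predL size_poly_gt0.
move=> x y Dx Dy xZ yZ; have [qx ->] := e x Dx.
move=> /eqP; rewrite mulf_eq0 invr_eq0 (negbTE qx) orbF => px.
by rewrite rZ in xZ.
Qed.

End tame.

Lemma itv_nbhs (R : realType) (J : interval R) (t : R) :
  t \in J -> ~ ends J t -> nbhs t [set` J].
Proof.
case: J => l u tJ nend.
have tl : (l < BLeft t)%O.
  move: tJ; rewrite itv_boundlr => /andP[+ _]; rewrite le_eqVlt => /orP[/eqP e|//].
  by case: nend; exists true; left.
have tu : (BRight t < u)%O.
  move: tJ; rewrite itv_boundlr => /andP[_]; rewrite le_eqVlt => /orP[/eqP e|//].
  by case: nend; exists false; right.
have : \forall x \near t, (l <= BLeft x)%O /\ (BRight x <= u)%O.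
  near=> x; split; near: x.
    case: l tl {tJ nend} => [[] l|[]] //=; rewrite ?bnd_simp => tl; try by near=> x.
      by near=> x; rewrite bnd_simp ltW//; near: x; exact: lt_nbhsr.
    by near=> x; rewrite bnd_simp; near: x; exact: lt_nbhsr.
  case: u tu {tJ nend} => [[] u|[]] //=; rewrite ?bnd_simp => tu; try by near=> x.
    by near=> x; rewrite bnd_simp; near: x; exact: lt_nbhsl.
  by near=> x; rewrite bnd_simp ltW//; near: x; exact: lt_nbhsl.
apply: filterS => x [lx xu] /=.
by rewrite itv_boundlr lx xu.
Unshelve. all: by end_near. Qed.

Lemma near_notin (R : realType) (Z : seq R) (t : R) : t \notin Z ->
  \forall x \near t, x \notin Z.
Proof.
elim: Z => [_|z Z IHZ]; first by apply: filterE => x.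
rewrite inE negb_or => /andP[tz /IHZ tZ]; near=> x; rewrite inE negb_or.
apply/andP; split; near: x; last exact: tZ.
by apply: open_nbhs_nbhs; split=> //; exact: open_neq.
Unshelve. all: by end_near. Qed.

(** Near [t] the predicate is constant, and a maximal interval ending at [t] has points arbitrarily
    near [t]. So [P] holds on a whole ball around [t], which maximality puts inside the interval;
    then [t] cannot be an end of it. *)
Lemma not_event (R : realType) (D : set R) (P : R -> Prop) (Z : seq R) (t : R) :
  (forall x y, D x -> D y -> x \notin Z -> y \notin Z -> P x -> P y) ->
  nbhs t D -> t \notin Z -> ~ events D P t.
Proof.
move=> cP Dt tZ [_ [J [[y0 Jy0] JE Jmax] Jt]].
have : \forall x \near t, D x /\ x \notin Z.
  by near=> x; split; near: x => //; exact: near_notin.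
move=> /nbhs_ballP[e /= e0 eP].
have NE x : `|t - x| < e -> D x /\ x \notin Z by move=> tx; exact: eP.
have ee : `|t - (t + e / 2)| < e /\ `|t - (t - e / 2)| < e.
  by rewrite !ltr_norml; split; apply/andP; split; lra.
(* A nonempty interval with end [t] meets the ball: its known point [y0] is in the ball, or
   [t + e / 2] or [t - e / 2] lies between [t] and [y0]. *)
have [j [Jj jt]] : exists j, [set` J] j /\ `|t - j| < e.
  have mJ := @interval_is_interval R J.
  case: J Jt Jy0 mJ {JE Jmax} => l u [b [lb|ub]] Jy0 mJ.
    have ty : t <= y0.
      by move: Jy0; rewrite lb /= itv_boundlr => /andP[]; case: (b); rewrite bnd_simp => // /ltW.
    have [yt|yt] := ltP `|t - y0| e; first by exists y0.
    exists (t + e / 2); split; last by case: ee.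
    rewrite /= itv_boundlr; move: Jy0; rewrite /= itv_boundlr => /andP[_ yu].
    have ty' : e <= y0 - t by move: yt; rewrite distrC ger0_norm// subr_ge0.
    apply/andP; split; first by rewrite lb; case: (b); rewrite bnd_simp; lra.
    by apply: le_trans yu; rewrite bnd_simp; lra.
  have ty : y0 <= t.
    by move: Jy0; rewrite ub /= itv_boundlr => /andP[_]; case: (b); rewrite bnd_simp => // /ltW.
  have [yt|yt] := ltP `|t - y0| e; first by exists y0.
  exists (t - e / 2); split; last by case: ee.
  rewrite /= itv_boundlr; move: Jy0; rewrite /= itv_boundlr => /andP[yl _].
  have ty' : e <= t - y0 by move: yt; rewrite ger0_norm// subr_ge0.
  apply/andP; split; first by apply: (le_trans yl); rewrite bnd_simp; lra.
  by rewrite ub; case: (b); rewrite bnd_simp; lra.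
pose N := [set x : R | `|t - x| < e].
have Pj : P j by have [] := JE _ Jj.
have NDP : N `<=` D `&` P.
  move=> x Nx; have [Dx xZ] := NE _ Nx; have [Dj jZ] := NE _ jt.
  by split=> //; exact: (cP j x).
have iJN : is_interval ([set` J] `|` N).
  have iJ := @interval_is_interval R J.
  have iN : is_interval N.
    move=> x y; rewrite /N /= !ltr_norml => xN yN z xzy.
    by rewrite ltr_norml; lra.
  have aux (A B : set R) x y z : is_interval A -> is_interval B -> A j -> B j ->
      A x -> B y -> x <= z <= y \/ y <= z <= x -> A z \/ B z.
    move=> iA iB Aj Bj Ax By.
    have [jz|zj] := leP j z => -[/andP[xz zy]|/andP[yz zx]].
    - by right; apply: (iB j y) => //; rewrite jz.
    - by left; apply: (iA j x) => //; rewrite jz.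
    - by left; apply: (iA x j) => //; rewrite xz ltW.
    - by right; apply: (iB y j) => //; rewrite yz ltW.
  move=> x y [Jx|Nx] [Jy|Ny] z xyz.
  - by left; apply: (iJ x y).
  - by apply: (aux _ _ x y) => //; left.
  - by apply: (aux _ _ y x) => //; right.
  - by right; apply: (iN x y).
(* [Rhull] turns the union of [J] and the ball into an [interval], which is what maximality
   quantifies over. *)
have NJ : N `<=` [set` J].
  have e' := (is_intervalP _).1 iJN.
  have sub : [set` J] `<=` [set` Rhull ([set` J] `|` N)].
    by rewrite -[X in _ `<=` X]/([set x | x \in Rhull ([set` J] `|` N)]) -e'; exact: subsetUl.
  have := Jmax _ sub.
  rewrite -[X in X `<=` D `&` P]/([set x | x \in Rhull ([set` J] `|` N)]) -e'.
  have JNDP : [set` J] `|` N `<=` D `&` P by rewrite subUset.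
  by move=> /(_ JNDP) JNJ; apply: subset_trans JNJ; exact: subsetUr.
have := NJ _ ee.1; have := NJ _ ee.2.
case: J Jt {Jy0 JE Jmax Jj iJN NJ} => l u [b [->|->]] /=; rewrite !itv_boundlr.
  by move=> /andP[+ _] _; case: b; rewrite bnd_simp; lra.
by move=> _ /andP[_]; case: b; rewrite bnd_simp; lra.
Unshelve. all: by end_near. Qed.

(** * Lines in the plane *)

Lemma cV2_eq (R : realType) (u v : 'cV[R]_2) :
  u 0 0 = v 0 0 -> u 1 0 = v 1 0 -> u = v.
Proof.
move=> e0 e1; apply/colP => i.
by have [->|->] : i = 0 \/ i = 1; [case: i => -[|[|]]//= ?; [left|right]; exact/val_inj|..].
Qed.

Section plane.
Variable R : realType.
Implicit Types p q r s x u v : 'cV[R]_2.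

Lemma cross_parallel u v : u != 0 -> cross u v = 0 -> exists c, v = c *: u.
Proof.
rewrite /cross => u0 uv.
have [u00|u00] := eqVneq (u 0 0) 0.
  have u10 : u 1 0 != 0.
    by apply: contraNneq u0 => u10; apply/eqP/cV2_eq; rewrite !mxE.
  exists (v 1 0 / u 1 0); apply: cV2_eq; rewrite !mxE; last by field.
  apply: (mulfI u10); rewrite u00 mulr0 mulr0; move: uv; rewrite u00; lra.
exists (v 0 0 / u 0 0); apply: cV2_eq; rewrite !mxE; first by field.
by apply: (mulfI u00); move: uv => /eqP; rewrite subr_eq0 => /eqP ->; field.
Qed.

Lemma line_neqP p q x : p != q -> line p q x <-> orient p q x = 0.
Proof.
move=> pq; split=> [[c ->]|/cross_parallel]; first by rewrite /orient /cross !mxE; ring.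
rewrite subr_eq0 eq_sym => /(_ pq)[c xc]; exists c.
by rewrite -xc addrC subrK.
Qed.

Lemma line_eqP p x : line p p x <-> x = p.
Proof.
split=> [[c ->]|->]; first by rewrite subrr scaler0 addr0.
by exists 0; rewrite scale0r addr0.
Qed.

Lemma lineP p q x :
  line p q x <-> (p <> q /\ orient p q x = 0) \/ (p = q /\ x = p).
Proof.
have [<-|/[dup] pq /eqP npq] := eqVneq p q.
  by rewrite line_eqP; split=> [|[[]|[]]//]; right.
by rewrite line_neqP//; split=> [|[[]|[]]//]; left.
Qed.

Lemma line_left p q : line p q p.
Proof. by exists 0; rewrite scale0r addr0. Qed.

Lemma meet_point_line p q r s : line p q (meet_point p q r s).
Proof. by eexists. Qed.

Lemma orient_meet_point p q r s x y : cross (q - p) (s - r) != 0 ->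
  orient x y (meet_point p q r s) * cross (q - p) (s - r) =
  orient x y p * cross (q - p) (s - r) + cross (r - p) (s - r) * cross (y - x) (q - p).
Proof.
by move=> pqrs; rewrite /orient /meet_point; move: pqrs; rewrite /cross !mxE => pqrs; field.
Qed.

Lemma meet_point_line2 p q r s : cross (q - p) (s - r) != 0 ->
  line r s (meet_point p q r s).
Proof.
move=> pqrs; have rs : r != s.
  by apply: contraNneq pqrs => ->; rewrite /cross !mxE; apply/eqP; ring.
apply/line_neqP => //; apply: (mulIf pqrs).
by rewrite orient_meet_point// /orient /cross !mxE; ring.
Qed.

Lemma meet_point_unique p q r s x : cross (q - p) (s - r) != 0 ->
  line p q x -> line r s x -> x = meet_point p q r s.
Proof.
move=> pqrs [c ->] [c' e].
have -> : c = cross (r - p) (s - r) / cross (q - p) (s - r); last by [].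
apply: (mulIf pqrs); rewrite divfK//.
have e0 := congr1 (fun M : 'cV[R]_2 => M 0 0) e.
have e1 := congr1 (fun M : 'cV[R]_2 => M 1 0) e.
move: e0 e1 {e pqrs}; rewrite /cross !mxE.
set a := p 0 0; set a' := p 1 0; set b := q 0 0; set b' := q 1 0.
set d := r 0 0; set d' := r 1 0; set f := s 0 0; set f' := s 1 0.
move=> e0 e1.
have -> : d - a = c * (b - a) - c' * (f - d) by lra.
have -> : d' - a' = c * (b' - a') - c' * (f' - d') by lra.
ring.
Qed.

Lemma line_shift p q x c : line p q x -> line p q (x + c *: (q - p)).
Proof. by move=> [c' ->]; exists (c' + c); rewrite scalerDl addrA. Qed.

(** Transversal lines meet; parallel ones that meet coincide, so that each contains the base point
    of the other. A line that is a single point is covered by the last two alternatives. *)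
Lemma lines_meetP p q r s :
  line p q `&` line r s !=set0 <->
  [\/ cross (q - p) (s - r) <> 0, line p q r | line r s p].
Proof.
split=> [[x [px rx]]|[/eqP c|pr|rp]]; last 3 first.
- by exists (meet_point p q r s); split; [exact: meet_point_line|exact: meet_point_line2].
- by exists r; split=> //; exact: line_left.
- by exists p; split=> //; exact: line_left.
have [c|/eqP c] := eqVneq (cross (q - p) (s - r)) 0; last exact: Or31.
have [pq|pq] := eqVneq p q.
  by move: px; rewrite -pq => /line_eqP xp; apply: Or33; rewrite -xp.
apply: Or32; have qp : q - p != 0 by rewrite subr_eq0 eq_sym.
have [k e] := cross_parallel qp c.
move: rx => [k' xe]; have -> : r = x + (- (k' * k)) *: (q - p).
  by rewrite scaleNr -scalerA -e xe addrK.
exact: line_shift.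
Qed.

(** A unique common point, recognised from the first line being a point, or from the first two being
    transversal and the third a proper line. The equation is that of [orient_meet_point] with the
    denominator cleared: the crossing of the first two lines is on the third. *)
Definition crossing_on p1 q1 p2 q2 p3 q3 : Prop :=
  (p1 = q1 /\ (line p2 q2 p1 /\ line p3 q3 p1)) \/
  (cross (q1 - p1) (q2 - p2) <> 0 /\ (p3 <> q3 /\
   orient p3 q3 p1 * cross (q1 - p1) (q2 - p2) +
   cross (p2 - p1) (q2 - p2) * cross (q3 - p3) (q1 - p1) = 0)).

Lemma crossing_on_single p1 q1 p2 q2 p3 q3 : crossing_on p1 q1 p2 q2 p3 q3 ->
  exists x, line p1 q1 `&` line p2 q2 `&` line p3 q3 = [set x].
Proof.
move=> [[<- [l2 l3]]|[/eqP c [/eqP pq e]]].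
  exists p1; apply/seteqP; split=> [x [[/line_eqP]]//|x ->].
  by do !split=> //; apply/line_eqP.
exists (meet_point p1 q1 p2 q2); apply/seteqP; split=> [x [[l1 l2] _]|x ->].
  exact: meet_point_unique.
split; first by split; [exact: meet_point_line|exact: meet_point_line2].
by apply/line_neqP => //; apply: (mulIf c); rewrite orient_meet_point// e mul0r.
Qed.

Lemma single_crossing_on p1 q1 p2 q2 p3 q3 x :
  line p1 q1 x -> line p2 q2 x -> line p3 q3 x -> p3 <> q3 ->
  cross (q1 - p1) (q2 - p2) != 0 -> crossing_on p1 q1 p2 q2 p3 q3.
Proof.
move=> l1 l2 l3 /eqP pq3 c; right; split; first exact/eqP.
split; first exact/eqP.
rewrite -orient_meet_point// -(meet_point_unique c l1 l2).
by have /line_neqP -> := l3; rewrite ?mul0r.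
Qed.

(** If no line is a point and no two are transversal, all three are parallel, and a common point can
    be shifted along their direction, so it is not the only one. Otherwise a cyclic permutation of
    the lines satisfies [crossing_on]. *)
Lemma three_linesP p1 q1 p2 q2 p3 q3 :
  (exists x, line p1 q1 `&` line p2 q2 `&` line p3 q3 = [set x]) <->
  crossing_on p1 q1 p2 q2 p3 q3 \/
  (crossing_on p2 q2 p3 q3 p1 q1 \/ crossing_on p3 q3 p1 q1 p2 q2).
Proof.
split; last first.
  case=> [/crossing_on_single//|[]/crossing_on_single[x e]]; exists x; rewrite -e.
    by rewrite [RHS]setIC setIA.
  by rewrite -[RHS]setIA setIC.
move=> [x e]; have : [set x] x by [].
rewrite -e => -[[l1 l2] l3].
have [pq1|/eqP pq1] := eqVneq p1 q1.
  by move: (l1); rewrite -pq1 => /line_eqP xp; left; left; rewrite -xp.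
have [pq2|/eqP pq2] := eqVneq p2 q2.
  by move: (l2); rewrite -pq2 => /line_eqP xp; right; left; left; rewrite -xp.
have [pq3|/eqP pq3] := eqVneq p3 q3.
  by move: (l3); rewrite -pq3 => /line_eqP xp; right; right; left; rewrite -xp.
have [c12|c12] := eqVneq (cross (q1 - p1) (q2 - p2)) 0; last first.
  by left; exact: (single_crossing_on l1 l2 l3).
have [c23|c23] := eqVneq (cross (q2 - p2) (q3 - p3)) 0; last first.
  by right; left; exact: (single_crossing_on l2 l3 l1).
have [c31|c31] := eqVneq (cross (q3 - p3) (q1 - p1)) 0; last first.
  by right; right; exact: (single_crossing_on l3 l1 l2).
exfalso.
have d2 : q2 - p2 != 0 by rewrite subr_eq0 eq_sym; apply/eqP.
have d3 : q3 - p3 != 0 by rewrite subr_eq0 eq_sym; apply/eqP.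
have d1 : q1 - p1 != 0 by rewrite subr_eq0 eq_sym; apply/eqP.
have c21 : cross (q2 - p2) (q1 - p1) = 0 by rewrite -oppr0 -c12 /cross; ring.
have [k2 e2] := cross_parallel d2 c21.
have [k3 e3] := cross_parallel d3 c31.
have : [set x] (x + 1 *: (q1 - p1)).
  rewrite -e; split; first split; first exact: line_shift.
    by rewrite e2 scale1r; exact: line_shift.
  by rewrite e3 scale1r; exact: line_shift.
by move=> /= /eqP; rewrite scale1r -[X in _ == X]addr0 (inj_eq (addrI _)) (negPf d1).
Qed.

End plane.

(** * Conditions on moving lines *)

Section tame_plane.
Variables (R : realType) (D : set R).

Definition vfrac_on (N : nat) (g : R -> 'cV[R]_2) : Prop :=
  forall i, frac_on D N (fun t => g t i 0).

Lemma vfrac_on_sub M N g h : vfrac_on M g -> vfrac_on N h ->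
  vfrac_on (M + N) (fun t => g t - h t).
Proof.
move=> gM hN i; apply: frac_on_ext (frac_on_sub (gM i) (hN i)) => t _.
by rewrite !mxE.
Qed.

Lemma frac_on_cross M N g h : vfrac_on M g -> vfrac_on N h ->
  frac_on D ((M + N) + (M + N)) (fun t => cross (g t) (h t)).
Proof.
by move=> gM hN; apply: frac_on_sub; apply: frac_on_mul; [exact: gM|exact: hN|exact: gM|exact: hN].
Qed.

Lemma tame_leq M N P : (M <= N)%N -> @tame R D M P -> tame D N P.
Proof. by move=> MN [Z [sz c]]; exists Z; split=> //; exact: leq_trans MN. Qed.

Variable N : nat.

Lemma tame_eq p q : vfrac_on N p -> vfrac_on N q ->
  tame D (4 * N) (fun t => p t = q t).
Proof.
move=> pN qN; have pq := vfrac_on_sub pN qN.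
apply: tame_leq (tame_ext _ (tame_and (tame_eq0 (pq 0)) (tame_eq0 (pq 1)))); first by lia.
move=> t _; split=> [[]|->]; last by rewrite subrr !mxE.
rewrite !mxE => /eqP; rewrite subr_eq0 => /eqP e0 /eqP; rewrite subr_eq0 => /eqP e1.
exact: cV2_eq.
Qed.

Lemma frac_on_orient p q x : vfrac_on N p -> vfrac_on N q -> vfrac_on N x ->
  frac_on D (8 * N) (fun t => orient (p t) (q t) (x t)).
Proof.
move=> pN qN xN.
by apply: frac_on_leq (frac_on_cross (vfrac_on_sub qN pN) (vfrac_on_sub xN pN)); lia.
Qed.

Lemma frac_on_cross_sub p q r s :
  vfrac_on N p -> vfrac_on N q -> vfrac_on N r -> vfrac_on N s ->
  frac_on D (8 * N) (fun t => cross (q t - p t) (s t - r t)).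
Proof.
move=> pN qN rN sN.
by apply: frac_on_leq (frac_on_cross (vfrac_on_sub qN pN) (vfrac_on_sub sN rN)); lia.
Qed.

Lemma tame_line p q x : vfrac_on N p -> vfrac_on N q -> vfrac_on N x ->
  tame D (20 * N) (fun t => line (p t) (q t) (x t)).
Proof.
move=> pN qN xN; have pq := tame_eq pN qN.
apply: tame_leq (tame_ext _ (tame_or
   (tame_and (tame_not pq) (tame_eq0 (frac_on_orient pN qN xN)))
   (tame_and pq (tame_eq xN pN)))); first by lia.
by move=> t _; rewrite lineP.
Qed.

Lemma tame_lines_meet p q r s :
  vfrac_on N p -> vfrac_on N q -> vfrac_on N r -> vfrac_on N s ->
  tame D (48 * N) (fun t => line (p t) (q t) `&` line (r t) (s t) !=set0).
Proof.
move=> pN qN rN sN.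
apply: tame_leq (tame_ext _ (tame_or (tame_not (tame_eq0 (frac_on_cross_sub pN qN rN sN)))
  (tame_or (tame_line pN qN rN) (tame_line rN sN pN)))); first by lia.
move=> t _; rewrite lines_meetP; split=> [[|[]]|[]]; try by [exact: Or31|exact: Or32|exact: Or33|left].
- by right; left.
- by right; right.
Qed.

(** The first alternative takes [4 + 20 + 20] and the second [8 + 4 + 32] times [N]; the sum 88 is
    rounded up. *)
Lemma tame_crossing_on p1 q1 p2 q2 p3 q3 :
  vfrac_on N p1 -> vfrac_on N q1 -> vfrac_on N p2 -> vfrac_on N q2 ->
  vfrac_on N p3 -> vfrac_on N q3 ->
  tame D (100 * N)
    (fun t => crossing_on (p1 t) (q1 t) (p2 t) (q2 t) (p3 t) (q3 t)).
Proof.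
move=> P1 Q1 P2 Q2 P3 Q3.
have c12 := frac_on_cross_sub P1 Q1 P2 Q2.
apply: tame_leq (tame_or
  (tame_and (tame_eq P1 Q1) (tame_and (tame_line P2 Q2 P1) (tame_line P3 Q3 P1)))
  (tame_and (tame_not (tame_eq0 c12)) (tame_and (tame_not (tame_eq P3 Q3))
    (tame_eq0 (frac_on_add (frac_on_mul (frac_on_orient P3 Q3 P1) c12)
       (frac_on_mul (frac_on_cross_sub P1 P2 P2 Q2) (frac_on_cross_sub P3 Q3 P1 Q1))))))).
by lia.
Qed.

Lemma tame_three_lines p1 q1 p2 q2 p3 q3 :
  vfrac_on N p1 -> vfrac_on N q1 -> vfrac_on N p2 -> vfrac_on N q2 ->
  vfrac_on N p3 -> vfrac_on N q3 ->
  tame D (300 * N) (fun t => exists x, line (p1 t) (q1 t) `&` line (p2 t) (q2 t) `&`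
                                       line (p3 t) (q3 t) = [set x]).
Proof.
move=> P1 Q1 P2 Q2 P3 Q3.
apply: tame_leq (tame_ext _ (tame_or (tame_crossing_on P1 Q1 P2 Q2 P3 Q3)
  (tame_or (tame_crossing_on P2 Q2 P3 Q3 P1 Q1) (tame_crossing_on P3 Q3 P1 Q1 P2 Q2)))).
  by lia.
by move=> t _; rewrite three_linesP.
Qed.

End tame_plane.

Lemma frac_on_rat (R : realType) (D : set R) (N : nat) (r : {poly R} * {poly R}) :
  (rat_degree r <= N)%N -> (forall t, D t -> rat_def r t) -> frac_on D N (rat_eval r).
Proof.
rewrite /rat_degree geq_max => /andP[r1 r2] rD; exists r.1, r.2; split.
- exact: leq_trans (leqSpred _) _.
- exact: leq_trans (leqSpred _) _.
- by move=> t Dt; split=> //; exact: rD.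
Qed.

(** A coordinate of a moving corner is a sum of three rational functions of degree at most
    [max_degree O], the reference corner being constant; over the product of the denominators the
    degree at most triples. *)
Lemma vfrac_on_corner (R : realType) (n : nat) (O : 'I_n -> object R) (i : 'I_n)
    (k : 'I_3) (D : set R) :
  atomic (O i) -> D `<=` [set` dom (O i)] ->
  vfrac_on D (3 * max_degree O) (moving_corner (O i) k).
Proof.
move=> [_ _ _ aff] Ddom j; set d := max_degree O.
have dO : (transf_degree (tf (O i)) <= d)%N.
  exact: (leq_bigmax (F := fun i => transf_degree (tf (O i)))).
have entry j' : frac_on D d (rat_eval ((tf (O i)).1 j j')).
  apply: frac_on_rat => [|t /Ddom/aff[[]]//].
  apply: leq_trans dO; rewrite leq_max; apply/orP; left.
  apply: leq_trans (leq_bigmax (F := fun i' => \max_j' rat_degree ((tf (O i)).1 i' j'))%N j).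
  exact: (leq_bigmax (F := fun j' => rat_degree ((tf (O i)).1 j j'))).
have entry' : frac_on D d (rat_eval ((tf (O i)).2 j 0)).
  apply: frac_on_rat => [|t /Ddom/aff[[]]//].
  apply: leq_trans dO; rewrite leq_max; apply/orP; right.
  exact: (leq_bigmax (F := fun j' => rat_degree ((tf (O i)).2 j' ord0))).
have m j' := frac_on_mul (entry j') (frac_on_cst D 0 (ref (O i) k j' 0)).
apply: frac_on_ext (frac_on_leq _ (frac_on_add (frac_on_add (m 0) (m 1)) entry')); last by lia.
move=> t _; rewrite /moving_corner /act /matrix_at !mxE; congr (_ + _).
rewrite big_ord_recl big_ord1 !mxE; congr (_ + _ * _).
  by rewrite (_ : lift _ _ = 1)//; exact/val_inj.
by rewrite (_ : lift _ _ = 1)//; exact/val_inj.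
Qed.

(** * Counting *)

(** A covering list, with repetitions and foreign elements allowed, since only upper bounds are
    wanted. It serves for sets of moments, of points and of sets of points. *)
Definition at_most (T : eqType) (N : nat) (A : set T) : Prop :=
  exists s : seq T, (size s <= N)%N /\ forall x, A x -> x \in s.

Section at_most.
Local Open Scope nat_scope.
Implicit Types (T K : eqType).

Lemma at_most_sub T M N (A B : set T) : M <= N -> A `<=` B ->
  at_most M B -> at_most N A.
Proof.
move=> MN AB [s [ss sB]]; exists s; split; first exact: leq_trans MN.
by move=> x /AB; exact: sB.
Qed.

Lemma at_mostU T M N (A B : set T) : at_most M A -> at_most N B ->
  at_most (M + N) (A `|` B).
Proof.
move=> [s [ss sA]] [s' [ss' sB]]; exists (s ++ s'); split.
  by rewrite size_cat leq_add.
by move=> x [/sA|/sB]; rewrite mem_cat => ->//; rewrite orbT.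
Qed.

Lemma at_most_seq T (s : seq T) : at_most (size s) [set x | x \in s].
Proof. by exists s. Qed.

Lemma at_most_image T K N (A : set T) (f : T -> K) :
  at_most N A -> at_most N (f @` A).
Proof.
move=> [s [ss sA]]; exists (map f s); split; first by rewrite size_map.
by move=> _ [x /sA xs <-]; exact: map_f.
Qed.

Lemma at_most_bigcup T K M N (I : set K) (A : K -> set T) :
  at_most M I -> (forall i, I i -> at_most N (A i)) ->
  at_most (M * N) (\bigcup_(i in I) A i).
Proof.
move=> [s [ss sI]] AN.
have /boolp.choice[f fP] : forall i, exists s' : seq T, size s' <= N /\
    (I i -> forall x, A i x -> x \in s').
  move=> i; have [/AN[s' [? ?]]|nI] := pselect (I i).
    by exists s'.
  by exists [::].
exists (flatten (map f s)); split.
  apply: leq_trans (leq_mul ss (leqnn _)).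
  elim: s {ss sI} => //= i s IHs; rewrite size_cat mulSn leq_add//.
  by have [] := fP i.
move=> x [i Ii Aix]; apply/flattenP; exists (f i); first by rewrite map_f// sI.
by have [_] := fP i; exact.
Qed.

Lemma at_most_setX T K M N (A : set T) (B : set K) :
  at_most M A -> at_most N B -> at_most (M * N) (A `*` B).
Proof.
move=> [s [ss sA]] [s' [ss' sB]]; exists [seq (x, y) | x <- s, y <- s']; split.
  by rewrite size_allpairs leq_mul.
by move=> [x y] [/= /sA xs /sB ys]; apply/allpairsP; exists (x, y).
Qed.

Lemma at_most_finType (T : finType) (A : set T) : at_most #|T| A.
Proof. by exists (enum T); rewrite cardE; split=> // x _; rewrite mem_enum. Qed.

(** [key] is a relation, so an element may have several keys and no canonical one has to be chosen;
    what counts is that a key belongs to at most one element. *)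
Lemma at_most_keyed T K N (A : set T) (B : set K) (key : K -> T -> Prop) :
  at_most N B -> (forall x, A x -> exists2 k, B k & key k x) ->
  (forall k x y, A x -> A y -> key k x -> key k y -> x = y) -> at_most N A.
Proof.
move=> [s [ss sB]] keyed key_inj.
have [[x0 _]|A0] := pselect (exists x, A x); last first.
  by exists [::]; split=> // x Ax; case: A0; exists x.
pose f k := if pselect (exists x, A x /\ key k x) is left e then projT1 (cid e) else x0.
exists (map f s); split; first by rewrite size_map.
move=> x Ax; have [k Bk kx] := keyed x Ax; apply/mapP; exists k; first exact: sB.
rewrite /f; case: pselect => [e|[]]; last by exists x.
by have [Ay ky] := projT2 (cid e); exact: key_inj kx ky.
Qed.

Lemma at_most_uniq T N (A : set T) (s : seq T) : at_most N A -> uniq s ->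
  (forall x, x \in s -> A x) -> size s <= N.
Proof.
move=> [s' [ss' sA]] us sA'; apply: leq_trans ss'; apply: uniq_leq_size => // x.
by move=> /sA' /sA.
Qed.

End at_most.

(** * The moments of the time partition *)

Lemma at_most_ends (R : realType) (J : interval R) : at_most 2 (ends J).
Proof.
case: J => l u; pose val (b : itv_bound R) := if b is BSide _ t then t else 0.
exists [:: val l; val u]; split=> // t [b [->|->]] /=; rewrite !inE eqxx//.
by rewrite orbT.
Qed.

(** [E] will be the set of end points of the time domains: at the other moments of [D] the set [D]
    is a neighbourhood, as [not_event] requires. *)
Lemma at_most_events (R : realType) (D E : set R) N (P : R -> Prop) :
  tame D N P -> (forall t, D t -> ~ E t -> nbhs t D) ->
  at_most N (events D P `\` E).
Proof.
move=> [Z [sZ cP]] DE; exists Z; split=> // t [ev nE].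
have Dt : D t by case: ev.
by apply: contrapT => /negP tZ; exact: (not_event cP (DE _ Dt nE) tZ ev).
Qed.

(** The first term counts the end points, the others the remaining events. The factors 9 and 27 are
    the choices of sides; 144 and 900 are the 48 and 300 of the line conditions times the factor 3
    of [vfrac_on_corner]. *)
Lemma at_most_partition_points (R : realType) (n : nat) (O : 'I_n -> object R) :
  (forall i, atomic (O i)) ->
  at_most (n * 2 + n * n * 9 * (144 * max_degree O) +
           n * n * n * 27 * (900 * max_degree O)) (partition_points O).
Proof.
move=> at_O; set d := max_degree O.
pose E := [set t | exists i, ends (dom (O i)) t].
have corner D i k : D `<=` [set` dom (O i)] -> vfrac_on D (3 * d) (moving_corner (O i) k).
  exact: vfrac_on_corner.
pose D2 i j := [set` dom (O i)] `&` [set` dom (O j)].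
pose D3 i j k := [set` dom (O i)] `&` [set` dom (O j)] `&` [set` dom (O k)].
have inner i t : [set` dom (O i)] t -> ~ E t -> nbhs t [set` dom (O i)].
  by move=> it nE; apply: itv_nbhs => // e; apply: nE; exists i.
have inner2 i j t : D2 i j t -> ~ E t -> nbhs t (D2 i j).
  by move=> [it jt] nE; apply: filterI; exact: inner.
have inner3 i j k t : D3 i j k t -> ~ E t -> nbhs t (D3 i j k).
  by move=> [ijt kt] nE; apply: filterI; [exact: inner2|exact: inner].
pose ev2 (x : 'I_n * 'I_n * ('I_3 * 'I_3)) := let: (i, j, (l1, l2)) := x in
  events (D2 i j) (fun t => carrier (O i) l1 t `&` carrier (O j) l2 t !=set0) `\` E.
pose ev3 (x : 'I_n * 'I_n * 'I_n * ('I_3 * 'I_3 * 'I_3)) :=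
  let: (i, j, k, (l1, l2, l3)) := x in
  events (D3 i j k) (fun t => exists x, carrier (O i) l1 t `&` carrier (O j) l2 t `&`
                                        carrier (O k) l3 t = [set x]) `\` E.
apply: (@at_most_sub _ _ _ _ (E `|` \bigcup_(x in setT) ev2 x `|` \bigcup_(x in setT) ev3 x)
  (leqnn _)).
  move=> t [[Et|[i [j [l1 [l2 [_ e]]]]]]|[i [j [k [l1 [l2 [l3 [_ e]]]]]]]].
  - by left; left.
  - have [Et|nE] := pselect (E t); first by left; left.
    by left; right; exists (i, j, (l1, l2)).
  - have [Et|nE] := pselect (E t); first by left; left.
    by right; exists (i, j, k, (l1, l2, l3)).
apply: at_mostU; first apply: at_mostU.
- have -> : E = \bigcup_(i in setT) ends (dom (O i)).
    by apply/seteqP; split=> [t [i ti]|t [i _ ti]]; exists i.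
  apply: at_most_bigcup => [|i _]; last exact: at_most_ends.
  by rewrite -[X in at_most X]card_ord; exact: at_most_finType.
- apply: at_most_bigcup => [|[[i j] [l1 l2]] _].
    have -> : (n * n * 9 = #|{: 'I_n * 'I_n * ('I_3 * 'I_3)}|)%N by rewrite !card_prod !card_ord.
    exact: at_most_finType.
  apply: at_most_events => [|t]; last exact: inner2.
  have -> : (144 * d = 48 * (3 * d))%N by lia.
  by apply: tame_lines_meet; apply: corner => t [].
- apply: at_most_bigcup => [|[[[i j] k] [[l1 l2] l3]] _].
    have -> : (n * n * n * 27 = #|{: 'I_n * 'I_n * 'I_n * ('I_3 * 'I_3 * 'I_3)}|)%N.
      by rewrite !card_prod !card_ord.
    exact: at_most_finType.
  apply: at_most_events => [|t]; last exact: inner3.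
  have -> : (900 * d = 300 * (3 * d))%N by lia.
  by apply: tame_three_lines; apply: corner => t [[]].
Qed.

(** * Objects counted over the time partition *)

Definition slabs_count (R : realType) (slabs : seq (slab R)) : nat :=
  sumn [seq size sl.2 | sl <- slabs].

Lemma size_objects_of (R : realType) (slabs : seq (slab R)) :
  size (objects_of slabs) = slabs_count slabs.
Proof.
rewrite /objects_of /slabs_count size_flatten /shape -map_comp; congr sumn.
by apply: eq_map => sl /=; rewrite size_map.
Qed.

(** A merged slab carries the list of one of the two slabs that it replaces. *)
Lemma merge2_count (R : realType) (s s' m : slab R) : merge2 s s' m ->
  (size m.2 <= size s.2 + size s'.2)%N.
Proof. by case=> *; rewrite ?leq_addl ?leq_addr. Qed.

Lemma merge_from_count (R : realType) (s : slab R) rest out : merge_from s rest out ->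
  (slabs_count out <= size s.2 + slabs_count rest)%N.
Proof.
rewrite /slabs_count; elim=> {s rest out} [s|s s' m rest out|s s' rest out _ _] /=.
- by [].
- move=> /merge2_count mc _ IH; apply: leq_trans IH _; rewrite addnA leq_add2r//.
- by rewrite leq_add2l.
Qed.

Lemma merge_all_count (R : realType) (slabs out : seq (slab R)) :
  merge_all slabs out -> (slabs_count out <= slabs_count slabs)%N.
Proof. by case=> // s rest out' /merge_from_count. Qed.

(** The factor 2 stands for a moment and the open interval after it; the latter is triangulated as
    the snapshot at its midpoint, so the same [B] applies. As [lists] asks for distinct filled
    triangles, a bound for the set of triangles bounds the list. *)
Lemma triangulate_count (R : realType) (n : nat) (O : 'I_n -> object R) B chi slabs :
  (forall t, at_most B (spatial_triangulation (snapshot O t))) ->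
  triangulate O chi slabs -> (slabs_count slabs <= 2 * B * size chi)%N.
Proof.
move=> BO.
have lists_size t ts : lists ts (spatial_triangulation (snapshot O t)) -> (size ts <= B)%N.
  move=> [u l _]; rewrite -(size_map (@filled R)).
  by apply: at_most_uniq (BO t) u _ => X /l.
have moment t sl : at_moment O t sl -> (size sl.2 <= B)%N.
  by move=> [ts /lists_size ? ->]; rewrite size_map.
have inter t1 t2 sl : on_interval O t1 t2 sl -> (size sl.2 <= B)%N.
  by move=> [objs [mv [/lists_size + _ _ ->]]]; rewrite size_map.
rewrite /slabs_count; elim=> [|t p /moment pB|t t' chi' p sl slabs' /moment pB /inter sB _ IH] //=.
  by rewrite addn0 muln1; lia.
by move: IH => /=; nia.
Qed.

Lemma st_triangulation_count (R : realType) (n : nat) (O : 'I_n -> object R) B out :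
  (forall i, atomic (O i)) ->
  (forall t, at_most B (spatial_triangulation (snapshot O t))) ->
  st_triangulation O out ->
  (size out <= 2 * B * (n * 2 + n * n * 9 * (144 * max_degree O) +
           n * n * n * 27 * (900 * max_degree O)))%N.
Proof.
move=> at_O BO [chi [slabs [slabs' [[srt part] tri mrg ->]]]].
rewrite size_objects_of; apply: (@leq_trans (slabs_count slabs)).
  by move: mrg; case: ifP => [_ /merge_all_count|_ ->].
apply: leq_trans (triangulate_count BO tri) _; rewrite leq_mul2l; apply/orP; right.
apply: at_most_uniq (at_most_partition_points at_O) _ _ => [|t /part//].
exact: lt_sorted_uniq.
Qed.

(** * Convex hulls of finite sets *)

Section convexity.
Variable R : realType.
Implicit Types (A B : set 'cV[R]_2) (a b p q x y z u v : 'cV[R]_2) (t : R).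

Definition is_convex A : Prop :=
  forall x y t, 0 <= t -> t <= 1 -> A x -> A y -> A (x + t *: (y - x)).

Lemma convex_setE A : @convex_set R 'cV[R]_2 A <-> is_convex A.
Proof.
have convE (l : {i01 R}) x y :
    @conv R (convex_lmodType 'cV[R]_2) l x y = y + l%:num *: (x - y).
  rewrite [LHS](_ : _ = l%:num *: x + (1 - l%:num) *: y)//.
  by apply: cV2_eq; rewrite !mxE; ring.
split=> cA.
  move=> x y t t0 t1 Ax Ay; apply: set_mem.
  by have := cA y x (Itv01 t0 t1) (mem_set Ay) (mem_set Ax); rewrite convE.
move=> x y l /set_mem Ax /set_mem Ay; apply: mem_set.
by rewrite convE; apply: cA.
Qed.

Lemma hull_convex A : is_convex (hull A).
Proof.
move=> x y t t0 t1 Ax Ay B [cB AB]; have cB' := (convex_setE B).1 cB.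
by apply: cB' => //; [exact: Ax|exact: Ay].
Qed.

Lemma sub_hull A : A `<=` hull A.
Proof. exact: sub_gen_smallest. Qed.

Lemma hull_min A B : is_convex B -> A `<=` B -> hull A `<=` B.
Proof. by move=> /convex_setE cB; exact: smallest_sub. Qed.

Lemma hull_sub A B : A `<=` B -> hull A `<=` hull B.
Proof.
by move=> AB; apply: hull_min; [exact: hull_convex|exact: subset_trans (@sub_hull _)].
Qed.

Lemma convexI A B : is_convex A -> is_convex B -> is_convex (A `&` B).
Proof. by move=> cA cB x y t t0 t1 [Ax Bx] [Ay By]; split; [exact: cA|exact: cB]. Qed.

Lemma convex_comb3 A x y z (a b c : R) : is_convex A -> 0 <= a -> 0 <= b -> 0 <= c ->
  a + b + c = 1 -> A x -> A y -> A z -> A (a *: x + b *: y + c *: z).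
Proof.
move=> cA a0 b0 c0 abc Ax Ay Az.
have [ab|ab] := eqVneq (a + b) 0.
  have -> : a = 0 by lra.
  have -> : b = 0 by lra.
  have -> : c = 1 by lra.
  by rewrite !scale0r !add0r scale1r.
have ab0 : 0 < a + b by rewrite lt_neqAle eq_sym ab addr_ge0.
have -> : a *: x + b *: y + c *: z =
    (x + (b / (a + b)) *: (y - x)) + c *: (z - (x + (b / (a + b)) *: (y - x))).
  by have -> : c = 1 - a - b by [lra]; apply: cV2_eq; rewrite !mxE; field.
apply: (cA) => //; first by lra.
by apply: (cA) => //; [rewrite divr_ge0// ltW|rewrite ler_pdivrMr// mul1r; lra].
Qed.

Lemma convex_line p q : is_convex (line p q).
Proof.
move=> _ _ t t0 t1 [c ->] [c' ->]; exists (c + t * (c' - c)).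
by apply: cV2_eq; rewrite !mxE; ring.
Qed.

(** [vertex] speaks of midpoints only; a point strictly between [x] and [y] is the midpoint of the
    two points of the segment at parameters [t - d] and [t + d]. *)
Lemma vertex_between A x y v t : is_convex A -> vertex A v -> A x -> A y ->
  0 < t < 1 -> v = x + t *: (y - x) -> x = y.
Proof.
move=> cA [Av extr] Ax Ay /andP[t0 t1] vE.
pose d := Num.min t (1 - t).
have d0 : 0 < d by rewrite lt_min t0 subr_gt0.
have dt : d <= t by rewrite ge_min lexx.
have dt' : d <= 1 - t by rewrite ge_min lexx orbT.
have : x + (t - d) *: (y - x) = x + (t + d) *: (y - x).
  apply: extr; try by apply: (cA) => //; lra.
  by rewrite vE; apply: cV2_eq; rewrite !mxE; field.
move=> /addrI /eqP; rewrite -subr_eq0 -scalerBl scaler_eq0 subr_eq0.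
case/orP=> [/eqP e|]; first by exfalso; lra.
by rewrite subr_eq0 eq_sym => /eqP.
Qed.

Lemma hull0 : hull (set0 : set 'cV[R]_2) = set0.
Proof. by rewrite -subset0; apply: hull_min => // x y t _ _ []. Qed.

(** The hull as a cone with apex [p], for inductions on a list of points; [p] is listed apart
    because [hull A] is empty when [A] is. *)
Lemma hull_join A p : hull (p |` A) =
  p |` [set z.1 + z.2 *: (p - z.1) | z in hull A `*` `[0, 1]%classic].
Proof.
apply/seteqP; split; last first.
  move=> w [->|[[x t] [/= Ax]]]; first by apply: sub_hull; left.
  rewrite in_itv/= => /andP[t0 t1] <-; apply: hull_convex => //.
    by move: Ax; apply: hull_sub => y; right.
  by apply: sub_hull; left.
apply: hull_min; last first.
  move=> x [->|Ax]; [by left|right]; exists (x, 0) => /=; last by rewrite scale0r addr0.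
  by split; [exact: sub_hull|rewrite /= in_itv/= lexx ler01].
have mem x t : hull A x -> 0 <= t -> t <= 1 ->
    (p |` [set z.1 + z.2 *: (p - z.1) | z in hull A `*` `[0, 1]%classic]) (x + t *: (p - x)).
  by move=> Ax t0 t1; right; exists (x, t) => //; split=> //; rewrite /= in_itv/= t0.
move=> w w' s s0 s1 [->|[[x t] [/= Ax+] <-]].
  move=> [->|[[y t] [/= Ay+] <-]]; first by rewrite subrr scaler0 addr0; left.
  rewrite in_itv/= => /andP[t0 t1].
  have -> : p + s *: (y + t *: (p - y) - p) = y + (1 - s * (1 - t)) *: (p - y).
    by apply: cV2_eq; rewrite !mxE; ring.
  by apply: mem => //; nra.
rewrite in_itv/= => /andP[t0 t1].
move=> [->|[[y t'] [/= Ay+] <-]].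
  have -> : x + t *: (p - x) + s *: (p - (x + t *: (p - x))) =
      x + (t + s * (1 - t)) *: (p - x) by apply: cV2_eq; rewrite !mxE; ring.
  by apply: mem => //; nra.
rewrite in_itv/= => /andP[t'0 t'1].
(* This is the total weight of [x] and [y]. If it is zero the combination is [p]; otherwise dividing
   by it gives a point of [hull A], from which the combination lies towards [p]. *)
have [e|e] := eqVneq ((1 - s) * (1 - t) + s * (1 - t')) 0.
  left => /=.
  have e1 : (1 - s) * (1 - t) = 0 by nra.
  have e2 : s * (1 - t') = 0 by nra.
  transitivity (p + ((1 - s) * (1 - t)) *: (x - p) + (s * (1 - t')) *: (y - p)).
    by apply: cV2_eq; rewrite !mxE; ring.
  by rewrite e1 e2 !scale0r !addr0.
set k := _ + _ in e.
have e0 : 0 < k by rewrite lt_neqAle eq_sym e /k; nra.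
have -> : x + t *: (p - x) + s *: (y + t' *: (p - y) - (x + t *: (p - x))) =
    (x + (s * (1 - t') / k) *: (y - x)) +
      (1 - k) *: (p - (x + (s * (1 - t') / k) *: (y - x))).
  by apply: cV2_eq; rewrite !mxE; move: e; rewrite /k => e; field.
apply: mem; last 2 first.
- by rewrite subr_ge0 /k; nra.
- by rewrite gerBl ltW.
apply: hull_convex => //; first by rewrite divr_ge0 ?(ltW e0)//; nra.
by rewrite ler_pdivrMr// mul1r /k; nra.
Qed.

Lemma continuous_line p u : continuous (fun t : R => p + t *: u).
Proof.
move=> t; apply: cvgD; first exact: cvg_cst.
exact: cvgZr_tmp.
Qed.

Lemma set_of_cons p (l : seq 'cV[R]_2) : [set` p :: l] = p |` [set` l].
Proof.
apply/seteqP; split=> [x|x] /=; rewrite inE.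
  by move=> /orP[/eqP|]; [left|right].
by move=> [->|->]; rewrite ?eqxx ?orbT.
Qed.

Lemma hull_compact (l : seq 'cV[R]_2) : compact (hull [set` l]).
Proof.
elim: l => [|p l IHl].
  rewrite (_ : [set` [::]] = set0) ?hull0; first exact: compact0.
  by apply/seteqP; split.
rewrite set_of_cons hull_join; apply: compactU; first exact: compact_set1.
apply: continuous_compact; last by apply: compact_setX => //; exact: segment_compact.
apply: continuous_subspaceT => -[x t].
apply: cvgD; first exact: cvg_fst.
apply: cvgZ; first exact: cvg_snd.
by apply: cvgB; [exact: cvg_cst|exact: cvg_fst].
Qed.

Lemma hull_closed (l : seq 'cV[R]_2) : closed (hull [set` l]).
Proof. by apply: compact_closed; [exact: norm_hausdorff|exact: hull_compact]. Qed.

(** By [hull_join] an extreme point lies on a segment from a point [x] of the smaller hull to [p],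
    and [vertex_between] makes it an end of that segment. *)
Lemma vertex_hull (l : seq 'cV[R]_2) v : vertex (hull [set` l]) v -> v \in l.
Proof.
elim: l v => [v []|p l IHl v].
  by rewrite (_ : [set` [::]] = set0) ?hull0//; apply/seteqP; split.
rewrite set_of_cons => vv; have [] := vv.
rewrite {1}hull_join => -[/= -> _|[[x t] [/= lx +]]]; first by rewrite inE eqxx.
rewrite in_itv/= => /andP[t0 t1] vE extr; rewrite inE.
have lp : hull [set` l] `<=` hull (p |` [set` l]) by apply: hull_sub => y; right.
have pp : hull (p |` [set` l]) p by apply: sub_hull; left.
have [te|t00] := eqVneq t 0.
  apply/orP; right; apply: IHl; have vx : v = x by rewrite -vE te scale0r addr0.
  rewrite vx; split=> // y z ly lz.
  by move=> e; apply: extr; [exact: lp|exact: lp|rewrite -e -vE te scale0r addr0].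
have [te|t11] := eqVneq t 1.
  by move: vE; rewrite te scale1r addrC subrK => <-; rewrite eqxx.
have xp : x = p.
  apply: (@vertex_between _ _ _ _ t) vv (lp _ lx) pp _ _ => //; first exact: hull_convex.
  by rewrite lt_neqAle eq_sym t00 t0 lt_neqAle t11 t1.
by rewrite -vE xp subrr scaler0 addr0 eqxx.
Qed.

End convexity.

(** * Signs and neighbourhoods in the plane *)

Lemma near_all_seq (T : eqType) (U : Type) (F : set_system U) (FF : Filter F)
    (l : seq T) (P : T -> U -> Prop) :
  (forall i, i \in l -> \forall u \near F, P i u) ->
  \forall u \near F, forall i, i \in l -> P i u.
Proof.
elim: l => [_|i l IHl Pl]; first exact: filterE.
apply: filterS2 (Pl i (mem_head _ _)) (IHl _) => [u Pi Pl' j|j jl].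
  by rewrite inE => /orP[/eqP ->|/Pl'].
by apply: Pl; rewrite inE jl orbT.
Qed.

Section plane_topology.
Variable R : realType.
Implicit Types (A : set 'cV[R]_2) (a b p q x y z u v w : 'cV[R]_2) (t : R).

Lemma orient_line a b x v t :
  orient a b (x + t *: v) = orient a b x + t * cross (b - a) v.
Proof. by rewrite /orient /cross !mxE; ring. Qed.

Lemma orient_between a b x y t :
  orient a b (x + t *: (y - x)) = (1 - t) * orient a b x + t * orient a b y.
Proof. by rewrite /orient /cross !mxE; ring. Qed.

Lemma orient_continuous a b : continuous (orient a b : 'cV[R]_2 -> R).
Proof.
have coord i : continuous (fun z : 'cV[R]_2 => (z - a) i 0 : R).
  have -> : (fun z : 'cV[R]_2 => (z - a) i 0) = (fun z => z i 0 - a i 0).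
    by apply/funext => z; rewrite !mxE.
  move=> y; apply: continuousB; last exact: cst_continuous.
  exact: (@coord_continuous R 2 1 i 0).
rewrite (_ : orient a b = fun z => (b - a) 0 0 * (z - a) 1 0 - (b - a) 1 0 * (z - a) 0 0)//.
move=> x; apply: (@continuousB R R^o _ (fun z => (b - a) 0 0 * (z - a) 1 0) (fun z => (b - a) 1 0 * (z - a) 0 0)).
  by apply: (@continuousM R _ (fun=> (b - a) 0 0) (fun z : 'cV[R]_2 => (z - a) 1 0)); [exact: cst_continuous|exact: coord].
by apply: (@continuousM R _ (fun=> (b - a) 1 0) (fun z : 'cV[R]_2 => (z - a) 0 0)); [exact: cst_continuous|exact: coord].
Qed.

Lemma near_line A x v : nbhs x A -> \forall t \near (0 : R), A (x + t *: v).
Proof.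
move=> Ax; have c := @continuous_line R x v 0.
have {}Ax : nbhs (x + 0 *: v) A by rewrite scale0r addr0.
exact: (c _ Ax).
Qed.

Lemma near_right (P : R -> Prop) :
  (\forall t \near (0 : R), P t) -> \forall t \near (0 : R)^'+, P t.
Proof. by move=> P0; apply: filterS P0 => t. Qed.

Lemma near_line_right A x v : nbhs x A -> \forall t \near (0 : R)^'+, A (x + t *: v).
Proof. by move=> Ax; exact: near_right (near_line v Ax). Qed.

Lemma orient_mul_near a b x : orient a b x != 0 ->
  nbhs x [set y | 0 < orient a b y * orient a b x].
Proof.
move=> abx; have c := @orient_continuous a b x.
apply: (c [set r | 0 < r * orient a b x]); apply: open_nbhs_nbhs; split.
  have -> : [set r | 0 < r * orient a b x] = ( *%R^~ (orient a b x)) @^-1` [set r : R | 0 < r].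
    by [].
  by apply: open_comp => [r _|]; [exact: mulrr_continuous|exact: open_gt].
by rewrite /= -expr2 exprn_even_gt0.
Qed.

Lemma right_pos_witness (P : R -> Prop) :
  (\forall t \near 0^'+, P t) -> exists2 t, 0 < t & P t.
Proof.
move=> P0; have : \forall t \near (0 : R)^'+, 0 < t /\ P t.
  by near=> t; split; near: t => //; exact: nbhs_right_gt.
by move=> /filter_ex[t []]; exists t.
Unshelve. all: by end_near. Qed.

Lemma interior_orient_gt0 A a b x : a != b -> interior A x ->
  (forall y, A y -> 0 <= orient a b y) -> 0 < orient a b x.
Proof.
move=> ab Ax pos.
(* [b - a] turned clockwise by a right angle: moving along [v] lowers [orient a b], yet a small move
   stays in [A], so [orient a b x] cannot be 0. *)
pose v : 'cV[R]_2 := \col_i (if i == 0 then (b - a) 1 0 else - (b - a) 0 0).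
have cv : cross (b - a) v < 0.
  rewrite -oppr_gt0 /cross !mxE /=.
  have -> : - ((b 0 0 - a 0 0) * - (b 0 0 - a 0 0) - (b 1 0 - a 1 0) * (b 1 0 - a 1 0)) =
      (b 0 0 - a 0 0) ^+ 2 + (b 1 0 - a 1 0) ^+ 2 by ring.
  rewrite lt_neqAle addr_ge0 ?sqr_ge0// andbT eq_sym paddr_eq0 ?sqr_ge0//.
  rewrite !expf_eq0 /= !subr_eq0; apply: contra ab => /andP[/eqP e0 /eqP e1].
  exact/eqP/cV2_eq.
have [t t0 /pos] := right_pos_witness (near_line_right v Ax).
by rewrite orient_line; nra.
Qed.

Lemma orientC a b x : orient b a x = - orient a b x.
Proof. by rewrite /orient /cross !mxE; ring. Qed.

Lemma interior_orient_lt0 A a b x : a != b -> interior A x ->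
  (forall y, A y -> orient a b y <= 0) -> orient a b x < 0.
Proof.
move=> ab Ax neg; rewrite -oppr_gt0 -orientC.
apply: (interior_orient_gt0 _ Ax); first by rewrite eq_sym.
by move=> y /neg; rewrite (orientC a b) oppr_ge0.
Qed.

(** In the triangle [a], [b], [y] the midpoint of [ab] has barycentric coordinates 1/2, 1/2, 0. Near
    it the first two stay positive, and the third is nonnegative on the side of [y]. *)
Lemma near_midpoint_triangle A a b y : is_convex A -> A a -> A b -> A y ->
  orient a b y != 0 ->
  \forall w \near 2^-1 *: (a + b), 0 <= orient a b w * orient a b y -> A w.
Proof.
move=> cA Aa Ab Ay o0; set m := 2^-1 *: (a + b).
have oa : orient b y m = 2^-1 * orient a b y.
  by rewrite /orient /cross /m !mxE; field.
have ob : orient y a m = 2^-1 * orient a b y.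
  by rewrite /orient /cross /m !mxE; field.
have oa0 : orient b y m != 0 by rewrite oa mulf_neq0// invr_eq0 pnatr_eq0.
have ob0 : orient y a m != 0 by rewrite ob mulf_neq0// invr_eq0 pnatr_eq0.
apply: filterS (filterI (orient_mul_near oa0) (orient_mul_near ob0)) => w [/= wa wb] wy.
have half (c : R) : 0 < c * (2^-1 * orient a b y) -> 0 <= c / orient a b y.
  rewrite mulrCA pmulr_rgt0 ?invr_gt0// => c0.
  have -> : c / orient a b y = (c * orient a b y) / (orient a b y ^+ 2).
    by field.
  by rewrite divr_ge0 ?sqr_ge0// ltW.
have -> : w = (orient b y w / orient a b y) *: a + (orient y a w / orient a b y) *: b +
              (orient a b w / orient a b y) *: y.
  by move: o0; rewrite /orient /cross !mxE => o0; apply: cV2_eq; rewrite !mxE; field.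
apply: convex_comb3 => //.
- by apply: half; rewrite -oa.
- by apply: half; rewrite -ob.
- have -> : orient a b w / orient a b y = (orient a b w * orient a b y) / (orient a b y ^+ 2).
    by field.
  by rewrite divr_ge0 ?sqr_ge0.
- by move: o0; rewrite /orient /cross !mxE => o0; field.
Qed.

(** The triangles over [ab] with apices [x] and [y] together cover a neighbourhood of the
    midpoint. *)
Lemma interior_midpoint A a b x y : is_convex A -> A a -> A b -> A x -> A y ->
  orient a b x < 0 -> 0 < orient a b y -> interior A (2^-1 *: (a + b)).
Proof.
move=> cA Aa Ab Ax Ay ox oy.
have ox0 : orient a b x != 0 by rewrite lt_eqF.
have oy0 : orient a b y != 0 by rewrite gt_eqF.
apply: filterS (filterI (near_midpoint_triangle cA Aa Ab Ax ox0)
  (near_midpoint_triangle cA Aa Ab Ay oy0)) => w [wx wy].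
by have [ow|ow] := leP (orient a b w) 0; [apply: wx; nra|apply: wy; nra].
Qed.

End plane_topology.

(** * The cells of the subdivision *)

Section same_face.
Variables (R : realType) (H : set 'cV[R]_2).
Hypothesis cH : is_convex H.
Implicit Types x y z : 'cV[R]_2.

Lemma same_faceC x y : same_face H x y -> same_face H y x.
Proof. by move=> [e e0 [? ?]]; exists e. Qed.

(** The segment from [x + e *: (x - y)] to [y + f *: (y - z)] crosses the prolongation of [zx]
    beyond [x]; the weight [e / (1 + e + f)] is the one for which [y] cancels. The end [z] is
    symmetric. *)
Lemma same_face_trans x y z : H x -> H y -> H z ->
  same_face H x y -> same_face H y z -> same_face H x z.
Proof.
move=> Hx Hy Hz [e e0 [Hx' Hy']] [f f0 [Hy'' Hz']].
have d0 : 0 < 1 + e + f by lra.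
exists (e * f / (1 + e + f)); first by rewrite divr_gt0// mulr_gt0.
split.
  have -> : x + (e * f / (1 + e + f)) *: (x - z) = (x + e *: (x - y)) +
      (e / (1 + e + f)) *: ((y + f *: (y - z)) - (x + e *: (x - y))).
    by apply: cV2_eq; rewrite !mxE; field; rewrite gt_eqF.
  by apply: cH => //; [rewrite divr_ge0; lra|rewrite ler_pdivrMr//; lra].
have -> : z + (e * f / (1 + e + f)) *: (z - x) = (z + f *: (z - y)) +
    (f / (1 + e + f)) *: ((y + e *: (y - x)) - (z + f *: (z - y))).
  by apply: cV2_eq; rewrite !mxE; field; rewrite gt_eqF.
by apply: cH => //; [rewrite divr_ge0; lra|rewrite ler_pdivrMr//; lra].
Qed.

Lemma same_face_le x y : H x -> H y -> same_face H x y ->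
  exists2 e : R, 0 < e & forall f, 0 <= f -> f <= e ->
    H (x + f *: (x - y)) /\ H (y + f *: (y - x)).
Proof.
move=> Hx Hy [e e0 [Hx' Hy']]; exists e => // f f0 fe.
have fe0 : 0 <= f / e by rewrite divr_ge0// ltW.
have fe1 : f / e <= 1 by rewrite ler_pdivrMr// mul1r.
have -> : x + f *: (x - y) = x + (f / e) *: ((x + e *: (x - y)) - x).
  by apply: cV2_eq; rewrite !mxE; field; rewrite gt_eqF.
have -> : y + f *: (y - x) = y + (f / e) *: ((y + e *: (y - x)) - y).
  by apply: cV2_eq; rewrite !mxE; field; rewrite gt_eqF.
by split; exact: cH.
Qed.

Lemma same_face_convex x : H x -> is_convex (H `&` same_face H x).
Proof.
move=> Hx y z t t0 t1 [Hy xy] [Hz xz]; split; first exact: cH.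
have [e e0 eP] := same_face_le Hx Hy xy; have [f f0 fP] := same_face_le Hx Hz xz.
pose g := Num.min e f.
have g0 : 0 < g by rewrite lt_min e0.
have [||Hx1 Hy1] := eP g; rewrite ?ge_min ?lexx//; first exact: ltW.
have [||Hx2 Hz1] := fP g; rewrite ?ge_min ?lexx ?orbT//; first exact: ltW.
exists g => //; split.
  have -> : x + g *: (x - (y + t *: (z - y))) = (x + g *: (x - y)) +
      t *: ((x + g *: (x - z)) - (x + g *: (x - y))).
    by apply: cV2_eq; rewrite !mxE; ring.
  exact: cH.
have -> : y + t *: (z - y) + g *: (y + t *: (z - y) - x) = (y + g *: (y - x)) +
    t *: ((z + g *: (z - x)) - (y + g *: (y - x))).
  by apply: cV2_eq; rewrite !mxE; ring.
exact: cH.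
Qed.

Lemma same_face_interior x y t : interior H x -> H y -> 0 < t -> t <= 1 ->
  same_face H x (y + t *: (x - y)).
Proof.
move=> ix Hy t0 t1.
have [e e0 He] := right_pos_witness (near_line_right (x - (y + t *: (x - y))) ix).
have Hx : H x := interior_subset ix.
pose g := Num.min e t.
have g0 : 0 < g by rewrite lt_min e0.
have ge : g <= e by rewrite ge_min lexx.
have gt : g <= t by rewrite ge_min lexx orbT.
exists g => //; split.
  have -> : x + g *: (x - (y + t *: (x - y))) =
     x + (g / e) *: ((x + e *: (x - (y + t *: (x - y)))) - x).
    by apply: cV2_eq; rewrite !mxE; field; rewrite gt_eqF.
  by apply: cH => //; [rewrite divr_ge0; lra|rewrite ler_pdivrMr//; lra].
have -> : y + t *: (x - y) + g *: (y + t *: (x - y) - x) =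
    y + (t - g * (1 - t)) *: (x - y).
  by apply: cV2_eq; rewrite !mxE; ring.
by apply: cH => //; nra.
Qed.

End same_face.

Lemma sgr_between (R : realDomainType) (a b c t : R) : 0 <= t -> t <= 1 ->
  Num.sg a = Num.sg c -> Num.sg b = Num.sg c ->
  Num.sg ((1 - t) * a + t * b) = Num.sg c.
Proof.
move=> t0 t1; have [c0|c0|c0] := ltgtP c 0.
- rewrite (ltr0_sg c0) => /eqP; rewrite sgr_cp0 => a0 /eqP; rewrite sgr_cp0 => b0.
  by apply/eqP; rewrite sgr_cp0; nra.
- rewrite (gtr0_sg c0) => /eqP; rewrite sgr_cp0 => a0 /eqP; rewrite sgr_cp0 => b0.
  by apply/eqP; rewrite sgr_cp0; nra.
- rewrite c0 sgr0 => /eqP; rewrite sgr_cp0 => /eqP -> /eqP; rewrite sgr_cp0 => /eqP ->.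
  by rewrite !mulr0 addr0 sgr0.
Qed.

Section cells.
Variables (R : realType) (s : seq {ffun 'I_3 -> 'cV[R]_2}).
Implicit Types (C : set 'cV[R]_2) (a b p q x y z u v : 'cV[R]_2) (t : R).
Implicit Types e : ('cV[R]_2 * 'cV[R]_2)%type.

Local Notation H := (hull (region s)).
Local Notation B := (bounding_segments s).

Definition corners : seq 'cV[R]_2 := [seq (T : {ffun 'I_3 -> _}) l | T <- s, l <- enum 'I_3].

Definition sides : seq ('cV[R]_2 * 'cV[R]_2) := [seq side T l | T <- s, l <- enum 'I_3].

Lemma size_corners : size corners = (3 * size s)%N.
Proof. by rewrite size_allpairs size_enum_ord mulnC. Qed.

Lemma size_sides : size sides = (3 * size s)%N.
Proof. by rewrite size_allpairs size_enum_ord mulnC. Qed.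

Lemma bounding_sides e : B e -> e \in sides.
Proof.
move=> [[T [l [Ts ->]]] _]; apply/allpairsP; exists (T, l); split=> //.
by rewrite mem_enum.
Qed.

Lemma segment_sub_line a b :
  segment a b `<=` [set z | exists2 t, 0 <= t <= 1 & z = a + t *: (b - a)].
Proof.
apply: hull_min; last first.
  move=> _ [->|->]; first by exists 0; rewrite ?lexx ?ler01// scale0r addr0.
  by exists 1; rewrite ?lexx ?ler01// scale1r addrC subrK.
move=> _ _ t t0 t1 [c /andP[c0 c1] ->] [d /andP[d0 d1] ->].
exists (c + t * (d - c)); first by apply/andP; split; nra.
by apply: cV2_eq; rewrite !mxE; ring.
Qed.

Lemma segment_mem a b t : 0 <= t -> t <= 1 -> segment a b (a + t *: (b - a)).
Proof. by move=> t0 t1; apply: hull_convex => //; apply: sub_hull; [left|right]. Qed.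

Lemma bounding_neq e : B e -> e.1 != e.2.
Proof.
case: e => p q [_ [u [v [/= /eqP uv uvpq]]]]; apply/eqP => pq; apply: uv.
have seg z : segment u v z -> z = p.
  by move=> /uvpq[/segment_sub_line[t _ ->] _]; rewrite -pq subrr scaler0 addr0.
have up : u = p by apply: seg; apply: sub_hull; left.
have vp : v = p by apply: seg; apply: sub_hull; right.
by rewrite up vp.
Qed.

Lemma hull_corners : H = hull [set` corners].
Proof.
apply/seteqP; split; apply: hull_min; try exact: hull_convex.
  move=> x [T Ts]; apply: hull_sub => _ [l _ <-] /=.
  by apply/allpairsP; exists (T, l); rewrite mem_enum.
move=> x /allpairsP[[T l] [/= Ts _ ->]]; apply: sub_hull; exists T => //.
by apply: sub_hull; exists l.
Qed.

Lemma closed_H : closed H.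
Proof. by rewrite hull_corners; exact: hull_closed. Qed.

Lemma convex_H : is_convex H.
Proof. exact: hull_convex. Qed.

Lemma vertex_H v : vertex H v -> v \in corners.
Proof. by rewrite hull_corners; exact: vertex_hull. Qed.

Lemma cell_of_refl x : H x -> cell_of s x x.
Proof.
move=> Hx; split=> //; exists 1 => //.
by rewrite subrr scaler0 addr0.
Qed.

Lemma cell_of_sub x : cell_of s x `<=` H.
Proof. by move=> y []. Qed.

Lemma cell_of_eq x y z : H x -> H y -> cell_of s x z -> cell_of s y z ->
  cell_of s x = cell_of s y.
Proof.
have sub x1 x2 : H x1 -> H x2 -> cell_of s x1 z -> cell_of s x2 z ->
    cell_of s x1 `<=` cell_of s x2.
  move=> H1 H2 [Hz f1 s1] [_ f2 s2] w [Hw fw sw]; split=> //.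
    apply: (same_face_trans convex_H H2 Hz Hw f2).
    by apply: (same_face_trans convex_H Hz H1 Hw _ fw); exact: same_faceC.
  by move=> e Be; rewrite sw// -s1// s2.
by move=> Hx Hy xz yz; apply/seteqP; split; exact: sub.
Qed.

Lemma cell_of_convex x : H x -> is_convex (cell_of s x).
Proof.
move=> Hx y z t t0 t1 [Hy fy sy] [Hz fz sz].
have [Hw fw] := same_face_convex convex_H Hx t0 t1 (conj Hy fy) (conj Hz fz).
split=> // e Be; rewrite orient_between; apply: sgr_between => //; [exact: sy|exact: sz].
Qed.

(** The product puts [y] weakly on the side of [x], whichever side that is; this yields the closed
    cell when [x] is on none of the lines. *)
Definition weak_cell x : set 'cV[R]_2 :=
  [set y | H y /\ forall e, B e -> 0 <= orient e.1 e.2 y * orient e.1 e.2 x].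

(** Not the [center] of a cell, but any point that can represent a polygon. *)
Definition polygon_center x : Prop :=
  interior H x /\ forall e, B e -> orient e.1 e.2 x != 0.

(** Any interior point of [C] will do: if it were on one of the lines, all of [C] would be, signs
    being constant on a cell, and [C] would have no interior. *)
Lemma polygon_cell_center C : polygon_cell s C ->
  exists2 x, polygon_center x & C = cell_of s x.
Proof.
move=> [[x Hx CE] [y iy]]; have Cy := interior_subset iy.
have CH : C `<=` H by rewrite CE; exact: cell_of_sub.
exists y; last first.
  rewrite CE; apply: (@cell_of_eq _ _ y) => //; first exact: CH.
    by rewrite -CE.
  by apply: cell_of_refl; exact: CH.
split=> [|e Be]; first exact: (interiorS CH iy).
apply/eqP => ye.
suff : 0 < orient e.1 e.2 y by rewrite ye ltxx.
apply: (interior_orient_gt0 (bounding_neq Be) iy) => z Cz; move: Cz Cy; rewrite CE => -[_ _ /(_ _ Be) sz] [_ _ /(_ _ Be) sy].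
by rewrite -sgr_ge0 sz -sy ye sgr0.
Qed.

Section polygon.
Variable x : 'cV[R]_2.
Hypothesis cx : polygon_center x.

Let Hx : H x. Proof. by case: cx => /interior_subset. Qed.

Lemma cell_sub_weak_cell : cell_of s x `<=` weak_cell x.
Proof.
move=> y [Hy _ sy]; split=> // e /sy sye.
by rewrite -sgr_ge0 sgrM sye -sgrM sgr_ge0 -expr2 sqr_ge0.
Qed.

Lemma weak_cell_convex : is_convex (weak_cell x).
Proof.
move=> y z t t0 t1 [Hy sy] [Hz sz]; split; first exact: convex_H.
move=> e Be; rewrite orient_between mulrDl -!mulrA addr_ge0// mulr_ge0//.
- by rewrite subr_ge0.
- exact: sy.
- exact: sz.
Qed.

Lemma weak_cell_push y t : weak_cell x y -> 0 < t -> t <= 1 ->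
  cell_of s x (y + t *: (x - y)).
Proof.
move=> [Hy sy] t0 t1; split.
- by apply: convex_H => //; exact: ltW.
- by apply: same_face_interior => //; [exact: convex_H|case: cx].
- move=> e Be; rewrite orient_between; have := sy e Be; have := cx.2 e Be.
  set o := orient _ _ x; set o' := orient _ _ y => o0 oo.
  have [c1|c1|c1] := ltgtP o 0; last by rewrite c1 eqxx in o0.
    have o'0 : o' <= 0 by rewrite -(nmulr_lge0 _ c1).
    by rewrite !ltr0_sg//; nra.
  have o'0 : 0 <= o' by rewrite -(pmulr_lge0 _ c1).
  by rewrite !gtr0_sg//; nra.
Qed.

(** This turns vertices and edges of [closure C] into statements on linear inequalities. A strictly
    wrong sign persists nearby, and a point of [weak_cell] enters the cell as soon as it moves
    towards [x]. *)
Lemma closure_cell : closure (cell_of s x) = weak_cell x.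
Proof.
apply/seteqP; split=> [y cy|y Wy].
  have Hy : H y.
    have := closed_H; rewrite closure_id => ->.
    by apply: (closureS (@cell_of_sub x)).
  split=> // e Be; rewrite leNgt; apply/negP => neg.
  have o0 : orient e.1 e.2 y != 0.
    by apply: contraTneq neg => ->; rewrite mul0r ltxx.
  have [z [Cz /= zy]] := cy _ (orient_mul_near o0).
  have [_ /(_ e Be)] := cell_sub_weak_cell Cz.
  by nra.
move=> A Ay.
have : \forall t \near (0 : R)^'+, A (y + t *: (x - y)) /\ t <= 1.
  near=> t; split; near: t; first exact: near_line_right.
  by apply: nbhs_right_le; exact: ltr01.
move=> /right_pos_witness[t t0 [At t1]]; exists (y + t *: (x - y)); split=> //.
exact: weak_cell_push.
Unshelve. all: by end_near. Qed.

(** Lines through [v] are parallel to the motion and keep their value 0; the finitely many others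
    keep their sign for a while. *)
Lemma weak_signs_near v w : weak_cell x v ->
  (forall e, B e -> orient e.1 e.2 v = 0 -> cross (e.2 - e.1) w = 0) ->
  \forall t \near (0 : R), forall e, e \in sides -> B e ->
    0 <= orient e.1 e.2 (v + t *: w) * orient e.1 e.2 x.
Proof.
move=> [Hv sv] par.
apply: (@near_all_seq _ _ (nbhs (0 : R)) _ sides (fun e t => B e ->
    0 <= orient e.1 e.2 (v + t *: w) * orient e.1 e.2 x)) => e _.
have [Be|nBe] := pselect (B e); last by apply: nearW.
have [c0|c0] := eqVneq (orient e.1 e.2 v) 0.
  by near=> t => _; rewrite orient_line par// mulr0 c0 addr0 mul0r.
near=> t => _.
have : 0 < orient e.1 e.2 (v + t *: w) * orient e.1 e.2 v.
  by near: t; exact: (near_line _ (orient_mul_near c0)).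
set o := orient _ _ (_ + _) => oo.
have o20 : 0 < orient e.1 e.2 v ^+ 2 by rewrite exprn_even_gt0.
rewrite -(pmulr_rge0 _ o20).
have -> : orient e.1 e.2 v ^+ 2 * (o * orient e.1 e.2 x) =
  (o * orient e.1 e.2 v) * (orient e.1 e.2 v * orient e.1 e.2 x) by ring.
by rewrite mulr_ge0 ?sv// ltW.
Unshelve. all: by end_near. Qed.

(* A vertex of a cell cannot be moved back and forth within H along a direction
   that is parallel to the lines through it. *)
Lemma vertex_weak_cell_rigid v y z : vertex (weak_cell x) v -> H y -> H z ->
  v = 2^-1 *: (y + z) ->
  (forall e, B e -> orient e.1 e.2 v = 0 -> cross (e.2 - e.1) (y - z) = 0) -> y = z.
Proof.
move=> [Wv extr] Hy Hz vE par.
have parN e : B e -> orient e.1 e.2 v = 0 -> cross (e.2 - e.1) (z - y) = 0.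
  by move=> Be ov; rewrite -oppr0 -(par e Be ov) /cross !mxE; ring.
have : \forall t \near (0 : R)^'+, t <= 2^-1 /\
    forall e, e \in sides -> B e ->
    0 <= orient e.1 e.2 (v + t *: (y - z)) * orient e.1 e.2 x /\
    0 <= orient e.1 e.2 (v + t *: (z - y)) * orient e.1 e.2 x.
  have half : \forall t \near (0 : R)^'+, t <= 2^-1.
    by apply: nbhs_right_le; rewrite invr_gt0.
  have k1 := near_right (weak_signs_near Wv par).
  have k2 := near_right (weak_signs_near Wv parN).
  near=> t; split; first by near: t; exact: half.
  move=> e es Be; split; move: e es Be; near: t; [exact: k1|exact: k2].
move=> /right_pos_witness[t t0 [t2 tP]].
have W1 : weak_cell x (v + t *: (y - z)).
  split=> [|e Be]; last by have [] := tP e (bounding_sides Be) Be.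
  have -> : v + t *: (y - z) = y + (2^-1 - t) *: (z - y).
    by rewrite vE; apply: cV2_eq; rewrite !mxE; field.
  by apply: convex_H => //; lra.
have W2 : weak_cell x (v + t *: (z - y)).
  split=> [|e Be]; last by have [] := tP e (bounding_sides Be) Be.
  have -> : v + t *: (z - y) = y + (2^-1 + t) *: (z - y).
    by rewrite vE; apply: cV2_eq; rewrite !mxE; field.
  by apply: convex_H => //; lra.
have : v + t *: (y - z) = v + t *: (z - y).
  by apply: extr => //; apply: cV2_eq; rewrite !mxE; field.
move=> /addrI/(scalerI (lt0r_neq0 t0)) yz.
have e0 := congr1 (fun M : 'cV[R]_2 => M 0 0) yz.
have e1 := congr1 (fun M : 'cV[R]_2 => M 1 0) yz.
by move: e0 e1; rewrite !mxE => e0 e1; apply: cV2_eq; lra.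
Unshelve. all: by end_near. Qed.

End polygon.
End cells.

Lemma not_vertexP (R : realType) (A : set 'cV[R]_2) v : A v -> ~ vertex A v ->
  exists y z, [/\ A y, A z, v = 2^-1 *: (y + z) & y <> z].
Proof.
move=> Av nv; apply: contrapT => no; apply: nv; split=> // y z Ay Az vE.
by apply: contrapT => yz; apply: no; exists y, z.
Qed.

(** Of three distinct points of a line, one is strictly between the other two and hence not
    extreme. *)
Lemma at_most_line_vertex (R : realType) (A : set 'cV[R]_2) (p q : 'cV[R]_2) :
  is_convex A -> p != q -> at_most 2 (vertex (line p q `&` A)).
Proof.
move=> cA pq; set V := vertex _.
have cL : is_convex (line p q `&` A) by apply: convexI => //; exact: convex_line.
pose pt (c : R) := p + c *: (q - p).
have pt_inj c d : pt c = pt d -> c = d.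
  move=> /addrI/eqP; rewrite -subr_eq0 -scalerBl scaler_eq0 subr_eq0.
  by rewrite [q - p == 0]subr_eq0 [q == p]eq_sym (negPf pq) orbF => /eqP.
have mid (a b c : R) : a < b -> b < c -> V (pt a) -> V (pt b) -> V (pt c) -> False.
  move=> ab bc [Aa _] Vb [Ac _].
  have ca : 0 < c - a by lra.
  have bE : pt b = pt a + ((b - a) / (c - a)) *: (pt c - pt a).
    by rewrite /pt; apply: cV2_eq; rewrite !mxE; field; rewrite gt_eqF.
  have /pt_inj : pt a = pt c.
    apply: (vertex_between cL Vb Aa Ac _ bE).
    by rewrite divr_gt0 ?ltr_pdivrMr//; lra.
  by lra.
have Vpt v : V v -> exists c, v = pt c by move=> [[[c ->] _] _]; exists c.
have [[v1 V1]|no] := pselect (exists v, V v); last first.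
  by exists [::]; split=> // v Vv; case: no; exists v.
have [[v2 V2 v12]|no] := pselect (exists2 v, V v & v != v1); last first.
  exists [:: v1]; split=> // v Vv; rewrite inE; apply: contrapT => /negP vv1.
  by case: no; exists v.
exists [:: v1; v2]; split=> // v Vv; rewrite !inE.
have [c1 e1] := Vpt _ V1; have [c2 e2] := Vpt _ V2; have [c e] := Vpt _ Vv.
have [/eqP//|c1c] := eqVneq c c1; first by rewrite e e1 => /eqP ->; rewrite eqxx.
have [cc2|c2c] := eqVneq c c2; first by rewrite e e2 cc2 eqxx orbT.
have c12 : c2 != c1 by apply: contraNneq v12 => c12; rewrite e1 e2 c12.
exfalso; subst v v1 v2.
move: c1c c2c c12; rewrite !neq_lt => /orP[h1|h1] /orP[h2|h2] /orP[h3|h3].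
- exact: (mid c c2 c1).
- exact: (mid c c1 c2).
- exact: (mid c2 c c1).
- by lra.
- by lra.
- exact: (mid c1 c c2).
- exact: (mid c2 c1 c).
- exact: (mid c1 c2 c).
Qed.

(** * Vertices and edges of the polygons *)

Section candidates.
Variables (R : realType) (s : seq {ffun 'I_3 -> 'cV[R]_2}).
Implicit Types (C : set 'cV[R]_2) (a b p q x y z u v : 'cV[R]_2) (t : R).
Implicit Types e : ('cV[R]_2 * 'cV[R]_2)%type.

Local Notation H := (hull (region s)).
Local Notation B := (bounding_segments s).

(* The points where a line of the subdivision may leave a cell. *)
Definition candidate e : set 'cV[R]_2 :=
  [set v | line e.1 e.2 v /\ [\/ vertex H v, vertex (line e.1 e.2 `&` H) v |
     exists2 e', B e' & cross (e.2 - e.1) (e'.2 - e'.1) != 0 /\ line e'.1 e'.2 v]].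

(** Such a point can be moved along [e] in both directions within [H], and every line of the
    subdivision through it is parallel to [e], so a small move changes no sign. *)
Lemma not_candidate e v : B e -> line e.1 e.2 v -> H v -> ~ candidate e v ->
  exists y z, [/\ H y, H z, v = 2^-1 *: (y + z), y <> z &
    exists2 k, y - z = k *: (e.2 - e.1) & forall e', B e' -> orient e'.1 e'.2 v = 0 ->
      cross (e'.2 - e'.1) (e.2 - e.1) = 0].
Proof.
move=> Be ev Hv nc.
have [|y [z [[[c yE] Hy] [[d zE] Hz] vE yz]]] := @not_vertexP _ (line e.1 e.2 `&` H) v (conj ev Hv).
  by move=> vv; apply: nc; split=> //; exact: Or32.
exists y, z; split=> //; exists (c - d).
  by rewrite yE zE; apply: cV2_eq; rewrite !mxE; ring.
move=> e' Be' oe'; apply/eqP; apply: contrapT => /negP ce'; apply: nc; split=> //; apply: Or33.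
exists e' => //; split; last by apply/line_neqP => //; exact: bounding_neq Be'.
by apply: contraNneq ce'; rewrite /cross => c0; apply/eqP; lra.
Qed.

Lemma vertex_candidate x e v : vertex (weak_cell s x) v ->
  B e -> line e.1 e.2 v -> candidate e v.
Proof.
move=> vv Be ev; apply: contrapT => nc.
have [y [z [Hy Hz vE yz [k kE par]]]] := not_candidate Be ev vv.1.1 nc.
apply: yz; apply: (vertex_weak_cell_rigid vv Hy Hz vE) => e' Be' /(par e' Be').
by rewrite kE /cross !mxE => c0; rewrite -[RHS](mulr0 k) -c0; ring.
Qed.

(** For a vertex on none of the lines the parallelism in [vertex_weak_cell_rigid] is vacuous, which
    makes it extreme in [H]. *)
Lemma vertex_candidate_or x v : vertex (weak_cell s x) v ->
  vertex H v \/ exists2 e, B e & candidate e v.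
Proof.
move=> vv; have [[e Be ev]|no] := pselect (exists2 e, B e & line e.1 e.2 v).
  by right; exists e => //; exact: vertex_candidate vv Be ev.
left; apply: contrapT => /(not_vertexP vv.1.1)[y [z [Hy Hz vE yz]]]; apply: yz.
apply: (vertex_weak_cell_rigid vv Hy Hz vE) => e Be oe; case: no; exists e => //.
by apply/line_neqP => //; exact: bounding_neq Be.
Qed.

Lemma at_most_corner : at_most (3 * size s) (vertex H).
Proof.
rewrite -size_corners; apply: at_most_sub (leqnn _) _ (at_most_seq _).
exact: vertex_H.
Qed.

Lemma at_most_bounding : at_most (3 * size s) B.
Proof.
rewrite -size_sides; apply: at_most_sub (leqnn _) _ (at_most_seq _).
exact: bounding_sides.
Qed.

(** At most [3 * size s] corners of [H], two extreme points on the line, and one crossing for each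
    of at most [3 * size s] lines. *)
Lemma at_most_candidate e : B e -> at_most (6 * size s + 2) (candidate e).
Proof.
move=> Be.
have := at_mostU (at_mostU at_most_corner (at_most_line_vertex (@convex_H _ s) (bounding_neq Be)))
  (at_most_image (fun e' => meet_point e.1 e.2 e'.1 e'.2) at_most_bounding).
apply: at_most_sub; first by lia.
move=> v [ev [vH|vl|[e' Be' [ce' e'v]]]]; [by left; left|by left; right|right].
by exists e' => //; rewrite -(meet_point_unique ce' ev e'v).
Qed.

(** The midpoint [m] is not interior to the closed cell. If a line passes through [m], then [a] and
    [b], both weakly on the side of [x], must be on it. If none does, the signs are stable near [m],
    so [m] is not interior to [H], and [H] cannot have points strictly on both sides of [ab]. *)
Lemma edge_weak_cell x a b : polygon_center s x -> edge (weak_cell s x) a b ->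
  [\/ exists2 e, B e & line e.1 e.2 a /\ line e.1 e.2 b,
      forall y, H y -> 0 <= orient a b y | forall y, H y -> orient a b y <= 0].
Proof.
move=> cx [ab [[Ha sa] _] [[Hb sb] _] fr]; set m := 2^-1 *: (a + b).
have mE : m = a + 2^-1 *: (b - a) by apply: cV2_eq; rewrite !mxE; field.
have segm : segment a b m by rewrite mE; apply: segment_mem; lra.
have [[Hm sm] nim] : weak_cell s x m /\ ~ interior (weak_cell s x) m.
  have [cm nim] := fr _ segm; split=> //; move: cm.
  rewrite -closure_cell//; have /closure_id <- // := @closed_closure _ (cell_of s x).
have [[e Be oe]|no] := pselect (exists2 e, B e & orient e.1 e.2 m = 0).
  apply: Or31; exists e => //.
  have := sa e Be; have := sb e Be; have := cx.2 e Be.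
  move: oe; rewrite mE orient_between; set o := orient _ _ x; set oa := orient _ _ a.
  set ob := orient _ _ b => oab oc0 ob0 oa0.
  have obE : ob = - oa by lra.
  have : oa * o = 0 by move: ob0; rewrite obE mulNr; lra.
  move=> /eqP; rewrite mulf_eq0 (negPf oc0) orbF => /eqP oaz.
  by split; apply/line_neqP; rewrite ?(bounding_neq Be)// -/oa -/ob ?obE oaz ?oppr0.
apply: contrapT => nor; apply: nim.
have iHm : interior H m.
  have [[y Hy yn]|ny] := pselect (exists2 y, H y & orient a b y < 0); last first.
    case: nor; apply: Or32 => y Hy; rewrite leNgt; apply/negP => yn; apply: ny.
    by exists y.
  have [[z Hz zp]|nz] := pselect (exists2 z, H z & 0 < orient a b z); last first.
    case: nor; apply: Or33 => z Hz; rewrite leNgt; apply/negP => zp; apply: nz.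
    by exists z.
  exact: (interior_midpoint (@convex_H _ s) Ha Hb Hy Hz).
have signs : \forall w \near m, forall e, e \in sides s -> B e ->
    0 <= orient e.1 e.2 w * orient e.1 e.2 x.
  apply: (@near_all_seq _ _ (nbhs m) _ (sides s) (fun e w => B e ->
    0 <= orient e.1 e.2 w * orient e.1 e.2 x)) => e _.
  have [Be|nBe] := pselect (B e); last by apply: nearW.
  have o0 : orient e.1 e.2 m != 0 by apply/eqP => oe; apply: no; exists e.
  near=> w => _.
  have : 0 < orient e.1 e.2 w * orient e.1 e.2 m.
    by near: w; exact: (orient_mul_near o0).
  set o := orient _ _ w => oo.
  have o20 : 0 < orient e.1 e.2 m ^+ 2 by rewrite exprn_even_gt0.
  rewrite -(pmulr_rge0 _ o20).
  have -> : orient e.1 e.2 m ^+ 2 * (o * orient e.1 e.2 x) =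
    (o * orient e.1 e.2 m) * (orient e.1 e.2 m * orient e.1 e.2 x) by ring.
  by rewrite mulr_ge0 ?sm// ltW.
near=> w; split; first by near: w; exact: iHm.
move=> e Be; have es := bounding_sides Be; move: e es Be.
by near: w; exact: signs.
Unshelve. all: by end_near. Qed.

(* Just beside the common initial part of the two edges there is a point that
   lies in both cells. *)
Lemma edge_unique x x' a b b' (k : R) : polygon_center s x -> polygon_center s x' ->
  edge (weak_cell s x) a b -> edge (weak_cell s x') a b' ->
  0 < k -> b' - a = k *: (b - a) -> 0 < orient a b x * orient a b x' ->
  cell_of s x = cell_of s x' /\ b = b'.
Proof.
move=> cx cx' [ab va vb _] [ab' va' vb' _] k0 b'E oo.
have Hx : H x by case: cx => /interior_subset.
have Hx' : H x' by case: cx' => /interior_subset.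
(* In units of [b - a] the edges have lengths 1 and [k]; [m] is chosen strictly inside both. *)
pose g := Num.min 1 k / 2.
have min0 : 0 < Num.min 1 k by rewrite lt_min ltr01.
have min1 : Num.min 1 k <= 1 by rewrite ge_min lexx.
have mink : Num.min 1 k <= k by rewrite ge_min lexx orbT.
have g0 : 0 < g by rewrite divr_gt0.
have g1 : g < 1 by rewrite /g; lra.
have gk : g < k by rewrite /g; lra.
pose m := a + g *: (b - a).
have Wm : weak_cell s x m.
  by apply: weak_cell_convex => //; [exact: ltW|exact: ltW|case: va|case: vb].
have b'c : b' = a + k *: (b - a) by rewrite -b'E addrC subrK.
have O'E : orient a b' x' = k * orient a b x'.
  by rewrite b'c /orient /cross !mxE; ring.
have OE : orient a b' x = k * orient a b x.
  by rewrite b'c /orient /cross !mxE; ring.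
have OO : 0 < orient a b' x * orient a b' x'.
  by rewrite OE O'E mulrACA mulr_gt0// mulr_gt0.
have O'0 : orient a b' x' != 0 by apply: contraTneq OO => ->; rewrite mulr0 ltxx.
have m1 : orient b' x' m = (1 - g / k) * orient a b' x'.
  by rewrite b'c /m /orient /cross !mxE; field; rewrite gt_eqF.
have m2 : orient x' a m = (g / k) * orient a b' x'.
  by rewrite b'c /m /orient /cross !mxE; field; rewrite gt_eqF.
have gk0 : 0 < g / k by rewrite divr_gt0.
have gk1 : 0 < 1 - g / k by rewrite subr_gt0 ltr_pdivrMr// mul1r.
have m10 : orient b' x' m != 0 by rewrite m1 mulf_neq0// gt_eqF.
have m20 : orient x' a m != 0 by rewrite m2 mulf_neq0// gt_eqF.
have : \forall t \near (0 : R)^'+, t <= 1 /\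
    (0 < orient b' x' (m + t *: (x - m)) * orient b' x' m /\
     0 < orient x' a (m + t *: (x - m)) * orient x' a m).
  have h1 := near_line_right (x - m) (orient_mul_near m10).
  have h2 := near_line_right (x - m) (orient_mul_near m20).
  near=> t; split; first by near: t; apply: nbhs_right_le; exact: ltr01.
  by split; near: t; [exact: h1|exact: h2].
move=> /right_pos_witness[t t0 [t1 []]].
set z := m + t *: (x - m) => z1 z2.
have z3 : orient a b' z = t * orient a b' x.
  by rewrite /z /m b'c /orient /cross !mxE; ring.
have pos (c : R) : 0 < c * orient a b' x' -> 0 < c / orient a b' x'.
  move=> c0; have -> : c / orient a b' x' = (c * orient a b' x') / (orient a b' x' ^+ 2).
    by field.
  by rewrite divr_gt0// exprn_even_gt0.
(* Barycentric coordinates of [z] in the triangle [a], [b'], [x']. All are positive, so [z] is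
   reached from a point [y] of the edge [ab'] by moving towards [x']. *)
pose al := orient b' x' z / orient a b' x'.
pose be := orient x' a z / orient a b' x'.
pose ga := orient a b' z / orient a b' x'.
have al0 : 0 < al.
  by apply: pos; move: z1; rewrite m1 mulrCA pmulr_rgt0.
have be0 : 0 < be.
  by apply: pos; move: z2; rewrite m2 mulrCA pmulr_rgt0.
have ga0 : 0 < ga by apply: pos; rewrite z3 -mulrA mulr_gt0.
have sum1 : al + be + ga = 1.
  by rewrite /al /be /ga; move: O'0; rewrite /orient /cross !mxE => O'0; field.
pose y := a + (be / (al + be)) *: (b' - a).
have W'y : weak_cell s x' y.
  apply: weak_cell_convex => //; last 2 first.
  - by case: va'.
  - by case: vb'.
  - by rewrite divr_ge0; lra.
  - by rewrite ler_pdivrMr; lra.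
have zE : z = y + ga *: (x' - y).
  have -> : y + ga *: (x' - y) = al *: a + be *: b' + ga *: x'.
    have gaE : ga = 1 - al - be by lra.
    by rewrite gaE /y; apply: cV2_eq; rewrite !mxE; field; rewrite gt_eqF// addr_gt0.
  rewrite /al /be /ga; move: (z) => w.
  by move: O'0; rewrite /orient /cross !mxE => O'0; apply: cV2_eq; rewrite !mxE; field.
have Cz : cell_of s x z by exact: weak_cell_push.
have C'z : cell_of s x' z by rewrite zE; apply: weak_cell_push => //; lra.
have CC := cell_of_eq Hx Hx' Cz C'z; split=> //.
have WW : weak_cell s x = weak_cell s x' by rewrite -!closure_cell// CC.
rewrite -WW in va' vb'; have cW := @weak_cell_convex _ s x.
(* If the lengths differed, the end of the shorter edge would be strictly inside the longer one and
   so no vertex of the common closed cell. *)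
have [k1|k1|k1] := ltgtP k 1.
- have kk : 0 < k < 1 by rewrite k0.
  by have /eqP := vertex_between cW vb' va.1 vb.1 kk b'c; rewrite (negPf ab).
- have kk : 0 < k^-1 < 1 by rewrite invr_gt0 k0 invf_lt1.
  have bc : b = a + k^-1 *: (b' - a) by rewrite b'E scalerA mulVf ?gt_eqF// scale1r addrC subrK.
  by have /eqP := vertex_between cW vb va'.1 vb'.1 kk bc; rewrite (negPf ab').
- by rewrite b'c k1 scale1r addrC subrK.
Unshelve. all: by end_near. Qed.

End candidates.

(** * The size of a spatial triangulation *)

Lemma segmentC (R : realType) (a b : 'cV[R]_2) : segment a b = segment b a.
Proof. by rewrite /segment setUC. Qed.

Lemma vertex_segment (R : realType) (a b : 'cV[R]_2) : vertex (segment a b) a.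
Proof.
split=> [|x y]; first by apply: sub_hull; left.
move=> /segment_sub_line[t /andP[t0 t1] ->] /segment_sub_line[r /andP[r0 r1] ->] e.
have : (t + r) *: (b - a) = 0.
  have -> : (t + r) *: (b - a) =
      2 *: (2^-1 *: ((a + t *: (b - a)) + (a + r *: (b - a))) - a).
    by apply: cV2_eq; rewrite !mxE; field.
  by rewrite -e subrr scaler0.
move=> /eqP; rewrite scaler_eq0 => /orP[/eqP tr|/eqP ->]; last by rewrite !scaler0.
have -> : t = 0 by lra.
by have -> : r = 0 by lra.
Qed.

Lemma ord3_consecutive (i j : 'I_3) : i != j -> j = ordS i \/ i = ordS j.
Proof.
case: i j => -[|[|[|//]]] i3 [[|[|[|//]]] j3] //= _;
  by [left; exact/val_inj|right; exact/val_inj].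
Qed.

(** The ends of the segment are extreme, hence corners of [T], and any two of three corners are
    cyclically consecutive. So an input segment is one of the sides from which the bounding segments
    are taken. *)
Lemma segment_side (R : realType) (T : {ffun 'I_3 -> 'cV[R]_2}) a b : a != b ->
  filled T = segment a b -> exists l, side T l = (a, b) \/ side T l = (b, a).
Proof.
move=> ab TE.
have corner v : vertex (filled T) v -> exists i, v = T i.
  have -> : filled T = hull [set` codom T].
    rewrite /filled; congr hull; apply/seteqP; split=> [_ [i _ <-]|_ /codomP[i ->]] /=.
      exact: codom_f.
    by exists i.
  by move=> /vertex_hull/codomP.
have [i ai] : exists i, a = T i by apply: corner; rewrite TE; exact: vertex_segment.
have [j bj] : exists i, b = T i.
  by apply: corner; rewrite TE segmentC; exact: vertex_segment.
have ij : i != j by apply: contraNneq ab => ij; rewrite ai bj ij.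
have [e|e] := ord3_consecutive ij.
  by exists i; left; rewrite /side -e -ai -bj.
by exists j; right; rewrite /side -e -ai -bj.
Qed.

Section counting.
Variables (R : realType) (s : seq {ffun 'I_3 -> 'cV[R]_2}).
Implicit Types (C X : set 'cV[R]_2) (a b p q x y z u v : 'cV[R]_2) (t r : R).
Implicit Types e : ('cV[R]_2 * 'cV[R]_2)%type.

Local Notation H := (hull (region s)).
Local Notation B := (bounding_segments s).

Definition along e r : 'cV[R]_2 := e.1 + r *: (e.2 - e.1).

(** The trace of [C] on the line of [e], as a set of reals; for a cell it is an interval, and its
    supremum gives the last end point. *)
Definition params e C : set R := [set r | C (along e r)].

Lemma params_interval e x r r' t : H x -> params e (cell_of s x) r ->
  params e (cell_of s x) r' -> r <= t -> t <= r' -> params e (cell_of s x) t.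
Proof.
move=> Hx Sr Sr' rt tr'; have [rr|rr] := eqVneq r r'.
  by have -> : t = r by lra.
have rr0 : 0 < r' - r by rewrite subr_gt0 lt_neqAle rr; lra.
have e' : along e t = along e r + ((t - r) / (r' - r)) *: (along e r' - along e r).
  by rewrite /along; apply: cV2_eq; rewrite !mxE; field; rewrite gt_eqF.
rewrite /params /= e'; apply: (cell_of_convex Hx) => //.
  by rewrite divr_ge0 ?subr_ge0//; lra.
by rewrite ler_pdivrMr// mul1r; lra.
Qed.

Lemma params_below_sup e x r t : H x -> has_ubound (params e (cell_of s x)) ->
  params e (cell_of s x) r -> r <= t -> t < sup (params e (cell_of s x)) ->
  params e (cell_of s x) t.
Proof.
move=> Hx ub Sr rt ts.
have hs : has_sup (params e (cell_of s x)) by split=> //; exists r.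
have ts0 : 0 < sup (params e (cell_of s x)) - t by rewrite subr_gt0.
have [r' Sr' r't] := sup_adherent ts0 hs.
by apply: (params_interval Hx Sr Sr' rt); lra.
Qed.

Lemma sign_near v w : (forall e, B e -> orient e.1 e.2 v = 0 -> cross (e.2 - e.1) w = 0) ->
  \forall t \near (0 : R), forall e, e \in sides s -> B e ->
    Num.sg (orient e.1 e.2 (v + t *: w)) = Num.sg (orient e.1 e.2 v).
Proof.
move=> par.
apply: (@near_all_seq _ _ (nbhs (0 : R)) _ (sides s) (fun e t => B e ->
    Num.sg (orient e.1 e.2 (v + t *: w)) = Num.sg (orient e.1 e.2 v))) => e _.
have [Be|nBe] := pselect (B e); last by apply: nearW.
have [c0|c0] := eqVneq (orient e.1 e.2 v) 0.
  by near=> t => _; rewrite orient_line par// mulr0 addr0.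
near=> t => _.
have : 0 < orient e.1 e.2 (v + t *: w) * orient e.1 e.2 v.
  by near: t; exact: (near_line _ (orient_mul_near c0)).
rewrite -sgr_gt0 sgrM; have [c1|c1|c1] := ltgtP (orient e.1 e.2 v) 0.
- rewrite (ltr0_sg c1) mulrN1 oppr_gt0 sgr_lt0 => c2; exact: ltr0_sg.
- rewrite (gtr0_sg c1) mulr1 sgr_gt0 => c2; exact: gtr0_sg.
- by move: (c0); rewrite c1 eqxx.
Unshelve. all: by end_near. Qed.

(** If the last point were no candidate, one could pass beyond it along [e] inside [H] without a
    change of sign, and would still be in the cell. *)
Lemma sup_params_candidate e x r r' : B e -> H x ->
  has_ubound (params e (cell_of s x)) -> params e (cell_of s x) r ->
  params e (cell_of s x) r' -> r < r' ->
  candidate s e (along e (sup (params e (cell_of s x)))).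
Proof.
move=> Be Hx ub Sr Sr' rr'; set S := params e _ in ub Sr Sr' *; set m := sup S.
have r'm : r' <= m by exact: ub_le_sup.
have below t : r <= t -> t < m -> S t by exact: params_below_sup.
have alongE c t : along e (c + t) = along e c + t *: (e.2 - e.1).
  by rewrite /along scalerDl addrA.
have Hm : H (along e m).
  apply: contrapT => nH.
  have nb : nbhs (along e m) (~` H).
    by apply: open_nbhs_nbhs; split=> //; apply: closed_openC; exact: closed_H.
  have : \forall t \near (0 : R)^'+, t <= m - r /\ ~ H (along e m + t *: - (e.2 - e.1)).
    have h := near_line_right (- (e.2 - e.1)) nb.
    near=> t; split; near: t; last exact: h.
    by apply: nbhs_right_le; lra.
  move=> /right_pos_witness[t t0 [tm]]; rewrite scalerN -scaleNr -alongE; apply.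
  by apply: (@cell_of_sub _ s x); apply: below; lra.
apply: contrapT => /(not_candidate Be (ex_intro _ m erefl) Hm).
move=> [y' [z' [Hy' Hz' vE' yz' [k' kE' par]]]].
(* The pair is reordered so that [y] comes after [z] in the direction of [e]. *)
have [y [z [k [Hy Hz vE kE k0]]]] : exists y z k,
    [/\ H y, H z, along e m = 2^-1 *: (y + z), y - z = k *: (e.2 - e.1) & 0 < k].
  have [k0|k0|k0] := ltgtP k' 0.
  - exists z', y', (- k'); split=> //; first by rewrite addrC.
      by rewrite scaleNr -kE' opprB.
    by rewrite oppr_gt0.
  - by exists y', z', k'.
  - by move: kE'; rewrite k0 scale0r => /eqP; rewrite subr_eq0 => /eqP.
have Hpm t : - (k / 2) <= t -> t <= k / 2 -> H (along e (m + t)).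
  move=> t1 t2; rewrite alongE vE.
  have -> : 2^-1 *: (y + z) + t *: (e.2 - e.1) = y + (2^-1 - t / k) *: (z - y).
    have -> : t *: (e.2 - e.1) = (t / k) *: (y - z).
      by rewrite kE scalerA divfK// gt_eqF.
    by apply: cV2_eq; rewrite !mxE; field; rewrite gt_eqF.
  apply: (@convex_H _ s) => //.
    by rewrite subr_ge0 ler_pdivrMr//; lra.
  by rewrite lerBlDr -lerBlDl ler_pdivlMr//; lra.
have par' e' : B e' -> orient e'.1 e'.2 (along e m) = 0 ->
    cross (e'.2 - e'.1) (- (e.2 - e.1)) = 0.
  move=> Be' /(par e' Be'); rewrite /cross !mxE => c0; lra.
have : \forall t \near (0 : R)^'+, [/\ t <= m - r, t <= k / 4,
    forall e', e' \in sides s -> B e' ->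
      Num.sg (orient e'.1 e'.2 (along e m + t *: (e.2 - e.1))) =
      Num.sg (orient e'.1 e'.2 (along e m)) &
    forall e', e' \in sides s -> B e' ->
      Num.sg (orient e'.1 e'.2 (along e m + t *: - (e.2 - e.1))) =
      Num.sg (orient e'.1 e'.2 (along e m))].
  have h1 := near_right (sign_near par).
  have h2 := near_right (sign_near par').
  near=> t; split.
  - by near: t; apply: nbhs_right_le; lra.
  - by near: t; apply: nbhs_right_le; lra.
  - by near: t; exact: h1.
  - by near: t; exact: h2.
move=> /right_pos_witness[t t0 [tm tk s1 s2]].
have Sm : S (m - t) by apply: below; lra.
have HSm : H (along e (m - t)) by exact: (cell_of_sub Sm).
have cE : cell_of s x = cell_of s (along e (m - t)).
  by apply: (cell_of_eq Hx HSm Sm); exact: cell_of_refl.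
have : S (m + t).
  rewrite /S /params /= cE; split.
  - by apply: Hpm; lra.
  (* The two points have parameters [2 * t] apart, so prolonging by half reaches [m - 2 * t] and
     [m + 2 * t], which are in [H] because [t <= k / 4]. *)
  - exists 2^-1; first by rewrite invr_gt0.
    have -> : along e (m - t) + 2^-1 *: (along e (m - t) - along e (m + t)) =
        along e (m + - (2 * t)).
      by rewrite /along; apply: cV2_eq; rewrite !mxE; field.
    have -> : along e (m + t) + 2^-1 *: (along e (m + t) - along e (m - t)) =
        along e (m + 2 * t).
      by rewrite /along; apply: cV2_eq; rewrite !mxE; field.
    by split; apply: Hpm; lra.
  - move=> e' Be'; rewrite !alongE scaleNr -scalerN.
    by rewrite s1 ?s2//; exact: bounding_sides.
by move=> /(ub_le_sup ub); rewrite -/m; lra.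
Unshelve. all: by end_near. Qed.

Definition incidences : set (('cV[R]_2 * 'cV[R]_2) * 'cV[R]_2) :=
  \bigcup_(e in B) (pair e @` candidate s e).

Lemma at_most_incidences :
  at_most (3 * size s * (6 * size s + 2)) incidences.
Proof.
apply: at_most_bigcup; first exact: at_most_bounding.
by move=> e Be; apply: at_most_image; exact: at_most_candidate.
Qed.

(** Two cells with the same key reach up to the same supremum and so overlap below it. The key
    records [r < r'], which excludes a trace of one point, and an upper bound, without which [sup]
    is a default value. *)
Lemma at_most_segment_closures :
  at_most (3 * size s * (6 * size s + 2))
    [set D | exists C T a b, [/\ segment_cell s C,
       [/\ T \in s, a != b & filled T = segment a b],
       contributes s a b, C `<=` filled T & D = closure C]].
Proof.
pose key (k : ('cV[R]_2 * 'cV[R]_2) * 'cV[R]_2) (D : set 'cV[R]_2) :=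
  exists x r r', [/\ H x /\ r < r', params k.1 (cell_of s x) r,
    params k.1 (cell_of s x) r',
    has_ubound (params k.1 (cell_of s x)) /\
      k = (k.1, along k.1 (sup (params k.1 (cell_of s x)))) &
    B k.1 /\ D = closure (cell_of s x)].
apply: (at_most_keyed (key := key) at_most_incidences); last first.
  move=> [e c] D D' _ _ [x [r [r' /= [[Hx rr] Sr Sr' [ub cE] [Be ->]]]]].
  move=> [x' [t [t' /= [[Hx' tt] St St' [ub' cE'] [_ ->]]]]]; congr closure.
  have supE : sup (params e (cell_of s x)) = sup (params e (cell_of s x')).
    have : along e (sup (params e (cell_of s x))) = along e (sup (params e (cell_of s x'))).
      by move: cE; rewrite cE' => -[].
    move=> /addrI/eqP; rewrite -subr_eq0 -scalerBl scaler_eq0 !subr_eq0.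
    by rewrite [e.2 == e.1]eq_sym (negPf (bounding_neq Be)) orbF => /eqP.
  have r'm : r' <= sup (params e (cell_of s x)) by exact: ub_le_sup.
  have t'm : t' <= sup (params e (cell_of s x')) by exact: ub_le_sup.
  pose w := (Num.max r t + sup (params e (cell_of s x))) / 2.
  have rw : r <= Num.max r t by rewrite le_max lexx.
  have tw : t <= Num.max r t by rewrite le_max lexx orbT.
  have mm : Num.max r t < sup (params e (cell_of s x)) by rewrite gt_max; apply/andP; split; lra.
  have Sw : params e (cell_of s x) w.
    by apply: (params_below_sup Hx ub Sr); rewrite /w; lra.
  have S'w : params e (cell_of s x') w.
    by apply: (params_below_sup Hx' ub' St); rewrite /w -?supE; lra.
  exact: cell_of_eq Hx Hx' Sw S'w.
move=> D [C [T [a [b [[[x Hx CE] _ [c [d [cd Cc Cd]]]] [Ts ab TE] con CT ->]]]]].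
have [e [Be segE]] : exists e, B e /\ segment a b = segment e.1 e.2.
  have [l [lE|lE]] := segment_side ab TE.
    exists (a, b); split=> //; split=> //; exists T, l; split=> //.
  exists (b, a); rewrite /= segmentC; split=> //; split; first by exists T, l.
  by move: con; rewrite /contributes segmentC.
have Cpar y : C y -> exists2 t, 0 <= t <= 1 & y = along e t.
  by move=> /CT; rewrite TE segE => /segment_sub_line.
have [tc _ cE] := Cpar _ Cc; have [td _ dE] := Cpar _ Cd.
have ub : has_ubound (params e (cell_of s x)).
  exists 1 => t; rewrite /params /= -CE => /Cpar[t' /andP[_ t'1]] /addrI/eqP.
  rewrite -subr_eq0 -scalerBl scaler_eq0 !subr_eq0 [e.2 == e.1]eq_sym.
  by rewrite (negPf (bounding_neq Be)) orbF => /eqP ->.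
have [r [r' [rr Sr Sr']]] : exists r r', [/\ r < r', params e (cell_of s x) r &
    params e (cell_of s x) r'].
  have [h|h|h] := ltgtP tc td.
  - by exists tc, td; rewrite /params /= -cE -dE -CE.
  - by exists td, tc; rewrite /params /= -cE -dE -CE.
  - by move: cd; rewrite cE dE h eqxx.
exists (e, along e (sup (params e (cell_of s x)))).
  exists e => //; exists (along e (sup (params e (cell_of s x)))) => //.
  exact: sup_params_candidate Be Hx ub Sr Sr' rr.
by exists x, r, r'; rewrite CE.
Qed.

(** A triangle is determined by its cell, which fixes the center, and its edge. The factor 4 is for
    two bits, the side of the cell and the direction along the line; the factor 2 is for the side of
    [H]. *)
Lemma at_most_polygon_triangles :
  at_most (3 * size s * (6 * size s + 2) * 4 +
           (3 * size s + 3 * size s * (6 * size s + 2)) * 2)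
    [set D | exists C a b, [/\ inner_polygon s C, edge (closure C) a b &
             D = hull [set center C; a; b]]].
Proof.
pose tri x a b (D : set 'cV[R]_2) := [/\ polygon_center s x, edge (weak_cell s x) a b &
  D = hull [set center (cell_of s x); a; b]].
have tri_unique x x' a b b' D D' (k : R) : tri x a b D -> tri x' a b' D' ->
    0 < k -> b' - a = k *: (b - a) -> 0 < orient a b x * orient a b x' -> D = D'.
  move=> [cx ed ->] [cx' ed' ->] k0 bk oo.
  by have [-> ->] := edge_unique cx cx' ed ed' k0 bk oo.
pose D1 := [set D | exists2 e, B e & exists x a b, tri x a b D /\ line e.1 e.2 a /\ line e.1 e.2 b].
pose D2 := [set D | exists x a b, tri x a b D /\
   ((forall y, H y -> 0 <= orient a b y) \/ (forall y, H y -> orient a b y <= 0))].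
apply: (@at_most_sub _ _ _ _ (D1 `|` D2) (leqnn _)).
  move=> D [C [a [b [[/polygon_cell_center[x cx ->] _] ed ->]]]].
  rewrite closure_cell// in ed.
  have [[e Be eab]|pos|neg] := edge_weak_cell cx ed.
  - by left; exists e => //; exists x, a, b.
  - by right; exists x, a, b; split=> //; left.
  - by right; exists x, a, b; split=> //; right.
apply: at_mostU.
  pose key (k : ('cV[R]_2 * 'cV[R]_2) * 'cV[R]_2 * (bool * bool)) (D : set 'cV[R]_2) :=
    let: (e, a, (lft, fwd)) := k in B e /\ line e.1 e.2 a /\
    exists x b c, [/\ tri x a b D, b - a = c *: (e.2 - e.1), c != 0,
       lft = (0 < orient e.1 e.2 x) & fwd = (0 < c)].
  have at4 : at_most 4 [set: bool * bool].
    by have := at_most_finType [set: bool * bool]; rewrite card_prod card_bool.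
  apply: (at_most_keyed (key := key) (at_most_setX at_most_incidences at4)).
    move=> D [e Be [x [a [b [tx [ea eb]]]]]].
    have [c [cE c0]] : exists c, b - a = c *: (e.2 - e.1) /\ c != 0.
      have [ca caE] := ea; have [cb cbE] := eb; exists (cb - ca).
      have bac : b - a = (cb - ca) *: (e.2 - e.1).
        by rewrite cbE caE; apply: cV2_eq; rewrite !mxE; ring.
      split=> //; apply: contraTneq isT => c0; have [_ [ab _ _ _] _] := tx.
      by move: ab; rewrite eq_sym -subr_eq0 bac c0 scale0r eqxx.
    exists (e, a, (0 < orient e.1 e.2 x, 0 < c)); last first.
      by split=> //; split=> //; exists x, b, c.
    split=> //; exists e => //; exists a => //.
    by have [_ [_ va _ _] _] := tx; exact: vertex_candidate va Be ea.
  move=> [[e a] [lft fwd]] D D' _ _ [Be [ea [x [b [c [tx cE c0 lE fE]]]]]].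
  move=> [_ [_ [x' [b' [c' [tx' cE' c0' lE' fE']]]]]].
  have [cx _ _] := tx; have [cx' _ _] := tx'.
  have cc : 0 < c' / c.
    move: c0 c0' fE'; rewrite fE !neq_lt => /orP[c1|c1] /orP[c2|c2].
    - by rewrite -mulrNN -invrN divr_gt0 ?oppr_gt0.
    - by rewrite c2 ltNge ltW.
    - by rewrite c1 ltNge ltW.
    - by rewrite divr_gt0.
  apply: (tri_unique _ _ _ _ _ _ _ _ tx tx' cc).
    by rewrite cE cE' scalerA divfK.
  (* As [a] is on the line of [e], the sides of [ab] are those of [e], exchanged if [c] is
     negative. *)
  have oE y : orient a b y = c * orient e.1 e.2 y.
    have -> : orient a b y = c * cross (e.2 - e.1) (y - a).
      by rewrite /orient cE /cross !mxE; ring.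
    by have [d ->] := ea; rewrite /orient /cross !mxE; ring.
  rewrite !oE mulrACA mulr_gt0//; first by rewrite -expr2 exprn_even_gt0.
  have := cx.2 e Be; have := cx'.2 e Be; move: lE'; rewrite lE.
  set o := orient _ _ x; set o' := orient _ _ x'; rewrite !neq_lt.
  move=> oo /orP[h1|h1] /orP[h2|h2].
  - by rewrite nmulr_rgt0.
  - by move: oo; rewrite h2 ltNge ltW.
  - by move: oo; rewrite h1 [0 < o]ltNge ltW.
  - by rewrite mulr_gt0.
pose ends := vertex H `|` \bigcup_(e in B) candidate s e.
pose key (k : 'cV[R]_2 * bool) (D : set 'cV[R]_2) := exists x b, tri x k.1 b D /\
  (if k.2 then forall y, H y -> 0 <= orient k.1 b y else forall y, H y -> orient k.1 b y <= 0).
have at_most_ends : at_most (3 * size s + 3 * size s * (6 * size s + 2)) ends.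
  apply: at_mostU; first exact: at_most_corner.
  by apply: at_most_bigcup => [|e Be]; [exact: at_most_bounding|exact: at_most_candidate].
have at2 : at_most 2 [set: bool] by have := at_most_finType [set: bool]; rewrite card_bool.
apply: (at_most_keyed (key := key) (at_most_setX at_most_ends at2)).
  move=> D [x [a [b [tx side]]]].
  have enda : ends a.
    have [_ [_ va _ _] _] := tx.
    have [|[e Be ea]] := vertex_candidate_or va; first by left.
    by right; exists e.
  by case: side => side; [exists (a, true)|exists (a, false)] => //; exists x, b.
move=> [a sd] D D' _ _ [x [b [/= tx sb]]] [x' [b' [/= tx' sb']]].
have [[ix _] [ab _ [[Hb _] _] _] _] := tx; have [[ix' _] [ab' _ [[Hb' _] _] _] _] := tx'.
(* Both edges start at [a] with [H] on the same side, so [b] and [b'] are each weakly on that side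
   of the other edge; the two orientations being opposite, both vanish. *)
have oC : orient a b' b = - orient a b b' by rewrite /orient /cross !mxE; ring.
have o0 : orient a b b' = 0.
  by case: sd sb sb' => /(_ b' Hb') h1 /(_ b Hb); rewrite oC; lra.
have ba0 : b - a != 0 by rewrite subr_eq0 eq_sym.
have [k bk] := cross_parallel ba0 o0.
have ok y : orient a b' y = k * orient a b y.
  by rewrite /orient bk /cross !mxE; ring.
(* An interior point of [H] is strictly on the same side of both edges, so they point in the same
   direction. *)
have [k0 oo] : 0 < k /\ 0 < orient a b x * orient a b x'.
  case: sd sb sb' => sb sb'.
    have p1 := interior_orient_gt0 ab ix sb; have p2 := interior_orient_gt0 ab ix' sb.
    have := interior_orient_gt0 ab' ix sb'; rewrite ok pmulr_lgt0//; split=> //.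
    exact: mulr_gt0.
  have p1 := interior_orient_lt0 ab ix sb; have p2 := interior_orient_lt0 ab ix' sb.
  have := interior_orient_lt0 ab' ix sb'; rewrite ok nmulr_llt0//; split=> //.
  by rewrite nmulr_rgt0.
exact: (tri_unique _ _ _ _ _ _ _ _ tx tx' k0 bk oo).
Qed.

(** With [m = size s] the three bounds add up to [126 * m ^ 2 + 49 * m], and 126 + 49 = 175. *)
Lemma at_most_spatial_triangulation :
  at_most (175 * size s ^ 2) (spatial_triangulation s).
Proof.
have points : at_most (size s)
    [set D | exists2 T, T \in s & [/\ is_point T, D = filled T &
             forall T', T' \in s -> ~ is_point T' -> ~ (filled T `<=` filled T')]].
  apply: at_most_sub (leqnn _) _ (at_most_image (@filled R) (at_most_seq s)).
  by move=> D [T Ts [_ -> _]]; exists T.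
apply: at_most_sub _ _ (at_mostU (at_mostU at_most_polygon_triangles
  at_most_segment_closures) points); last by [].
by case: (size s) => // m; nia.
Qed.

End counting.

(** [maxn 1] accounts for degree 0: under constant transformations the end points of the time
    domains still produce objects. *)
Theorem mainTheorem10 (R : realType) :
  exists K : nat, forall (n : nat) (O : 'I_n -> object R) (out : seq (object R)),
    (forall i : 'I_n, atomic (O i)) ->
    st_triangulation O out ->
    (size out <= K * (n ^ 5 * maxn 1 (max_degree O)))%N.
Proof.
(* 350 is twice 175, for a moment and an interval; the other factor adds the coefficients of the
   three terms that bound the number of partition points, each term being at most its coefficient
   times [n * n * n * d']. *)
exists (350 * (2 + 9 * 144 + 27 * 900))%N => n O out at_O st.
have snapshot_size t : (size (snapshot O t) <= n)%N.
  rewrite size_map (leq_trans (size_subseq (filter_subseq _ _)))//.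
  by rewrite size_enum_ord.
have atB t : at_most (175 * n ^ 2) (spatial_triangulation (snapshot O t)).
  apply: at_most_sub _ (@subset_refl _ _) (at_most_spatial_triangulation (snapshot O t)).
  by rewrite leq_mul2l leq_exp2r// snapshot_size.
apply: leq_trans (st_triangulation_count at_O atB st) _.
set d := max_degree O; set d' := maxn 1 d.
have d'1 : (1 <= d')%N by rewrite leq_max.
have dd' : (d <= d')%N by rewrite leq_max leqnn orbT.
have n1 : (n <= n * n * n * d')%N by case: (n) => // m; nia.
have n2 : (n * n * d <= n * n * n * d')%N.
  by apply: leq_mul => //; case: (n) => // m; nia.
have n3 : (n * n * n * d <= n * n * n * d')%N by exact: leq_mul.
have -> : (350 * (2 + 9 * 144 + 27 * 900) * (n ^ 5 * d') =
  2 * (175 * n ^ 2) * ((2 + 9 * 144 + 27 * 900) * (n * n * n * d')))%N by ring.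
by rewrite leq_mul2l; apply/orP; right; lia.
Qed.
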